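(* Let $F$ be a number field, $\mathfrak{p}$ a prime of $F$, $n\in\mathbb{N}$ odd, and $u_\mathfrak{p}\in\mathcal{O}_\mathfrak{p}^\times$. Then for every $S_\mathfrak{p}\in\mathrm{SqCl}(F_\mathfrak{p}^\times,\mathcal{O}_\mathfrak{p}^\times)$, $$A^*_{\mathfrak{p};n}(u_\mathfrak{p}S_\mathfrak{p})=A^*_{\mathfrak{p};n}(S_\mathfrak{p})$$ and $$B^*_{\mathfrak{p};n}(u_\mathfrak{p}S_\mathfrak{p})=\begin{cases}B^*_{\mathfrak{p};n}(S_\mathfrak{p})&\text{if }n\equiv1\pmod4,\\(u_\mathfrak{p},u_\mathfrak{p})_\mathfrak{p}\cdot B^*_{\mathfrak{p};n}(S_\mathfrak{p})&\text{if }n\equiv3\pmod4,\end{cases}$$ where $(\cdot,\cdot)_\mathfrak{p}$ is the Hilbert symbol on $F_\mathfrak{p}$.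
   Context: $F_\mathfrak{p},\mathcal{O}_\mathfrak{p}$ are the completions of $F$ and of its ring of integers $\mathcal{O}_F$ at $\mathfrak{p}$; $\mathrm{SqCl}(F_\mathfrak{p}^\times,\mathcal{O}_\mathfrak{p}^\times)=F_\mathfrak{p}^\times/(\mathcal{O}_\mathfrak{p}^\times)^2$, on which $\mathrm{ord}_\mathfrak{p}$ is well defined. For $n$ odd put $\mathfrak{h}_n=2\mathcal{O}_F$. A squareclass is normalized if its valuation is $\mathrm{ord}_\mathfrak{p}(\mathfrak{h}_n)$. Fix a squareclass $\pi_\mathfrak{p}$ of valuation $1$ and put $\widetilde{S_\mathfrak{p}}:=S_\mathfrak{p}\cdot\pi_\mathfrak{p}^{\mathrm{ord}_\mathfrak{p}(\mathfrak{h}_n)-\mathrm{ord}_\mathfrak{p}(S_\mathfrak{p})}$. All quadratic forms are non-degenerate. A form over $\mathcal{O}_\mathfrak{p}$ is $\mathcal{O}_\mathfrak{p}$-valued if its values on $\mathcal{O}_\mathfrak{p}^n$ lie in $\mathcal{O}_\mathfrak{p}$, primitive if in addition they generate $\mathcal{O}_\mathfrak{p}$. The Hessian matrix is $(\partial^2Q/\partial x_i\partial x_j)$, the Gram matrix half of it. A local genus is an $\mathcal{O}_\mathfrak{p}$-equivalence class; $\det_H\in\mathrm{SqCl}(F_\mathfrak{p}^\times,\mathcal{O}_\mathfrak{p}^\times)$ is its Hessian determinant. If $Q\sim\sum a_ix_i^2$ over $F_\mathfrak{p}$, the Hasse invariant is $c_\mathfrak{p}(Q)=\prod_{i<j}(a_i,a_j)_\mathfrak{p}$.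 The local density of a form with Gram matrix $G$ is $$\beta_{\mathfrak{p}}(Q)=\tfrac12\lim_{U\to\{G\}}\frac{\mathrm{Vol}\{X\in M_n(\mathcal{O}_\mathfrak{p}):{}^tXGX\in U\}}{\mathrm{Vol}(U)},$$ $U$ running over open neighborhoods of $G$ in $\mathrm{Sym}_n(F_\mathfrak{p})$ shrinking to $G$, with Haar measures giving $M_n(\mathcal{O}_\mathfrak{p})$ and $\mathrm{Sym}_n(\mathcal{O}_\mathfrak{p})$ volume $1$. For $n$ odd and $\sigma$ normalized there is exactly one primitive $\mathcal{O}_\mathfrak{p}$-valued rank $n$ local genus with $\det_H=\sigma$; $\beta_{n,\mathfrak{p}}(\sigma)$ is its local density. For $\varepsilon\in\{\pm1\}$, $\widetilde M^{*,\varepsilon}_{\mathfrak{p};n}(S_\mathfrak{p})=\sum_{G_\mathfrak{p}}\beta_{n,\mathfrak{p}}(\widetilde{S_\mathfrak{p}})/\beta_\mathfrak{p}(G_\mathfrak{p})$, the sum over primitive $\mathcal{O}_\mathfrak{p}$-valued rank $n$ local genera with $\det_H(G_\mathfrak{p})=S_\mathfrak{p}$ and $c_\mathfrak{p}(G_\mathfrak{p})=\varepsilon$; $A^*_{\mathfrak{p};n}=\widetilde M^{*,+}_{\mathfrak{p};n}+\widetilde M^{*,-}_{\mathfrak{p};n}$ and $B^*_{\mathfrak{p};n}=\widetilde M^{*,+}_{\mathfrak{p};n}-\widetilde M^{*,-}_{\mathfrak{p};n}$. *)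

(* Defs.v *)
From HB Require Import structures.
From mathcomp Require Import all_boot all_order all_algebra all_field.
From mathcomp Require Import all_classical all_reals all_analysis.
Import Order.TTheory GRing.Theory Num.Theory.
Import numFieldNormedType.Exports.

Set Implicit Arguments.
Unset Strict Implicit.
Unset Printing Implicit Defensive.

Local Open Scope classical_set_scope.
Local Open Scope ring_scope.
Local Open Scope quotient_scope.

Definition integral_over_int (F : fieldExtType rat) : {pred F} :=
  fun x => `[< integralOver (intr : int -> F) x >].

Lemma integral_over_int_subring_closed (F : fieldExtType rat) :
  subring_closed (@integral_over_int F).
Proof.
split=> [|x y /asboolP hx /asboolP hy|x y /asboolP hx /asboolP hy];
  apply/asboolP; [exact: integral1|exact: integral_sub|exact: integral_mul].
Qed.

HB.instance Definition _ (F : fieldExtType rat) :=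
  GRing.isSubringClosed.Build F (@integral_over_int F)
    (@integral_over_int_subring_closed F).

Record ring_of_integers (F : fieldExtType rat) :=
  RingOfIntegers { algint_val :> F; _ : algint_val \in @integral_over_int F }.

HB.instance Definition _ (F : fieldExtType rat) :=
  [isSub for @algint_val F].
HB.instance Definition _ (F : fieldExtType rat) :=
  [Choice of ring_of_integers F by <:].
HB.instance Definition _ (F : fieldExtType rat) :=
  [SubChoice_isSubComNzRing of ring_of_integers F by <:].

Fixpoint ideal_exp (A : nzRingType) (I : {pred A}) (k : nat) : set A :=
  if k is k'.+1 then
    [set x | exists (m : nat) (a b : 'I_m -> A),
        (forall i, a i \in I /\ ideal_exp I k' (b i))
        /\ x = \sum_(i < m) a i * b i]
  else setT.

(* A field with an integer-valued valuation [ord], whose uniformity is the one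
   defined by the valuation.  The value [ord 0] is unspecified. *)
HB.mixin Record Uniform_isValued K of GRing.Field K & Uniform K := {
  ord : K -> int;
  ordM_subproof : forall x y : K, x != 0 -> y != 0 -> ord (x * y) = ord x + ord y;
  ordD_subproof : forall x y : K, x != 0 -> y != 0 -> x + y != 0 ->
    Order.min (ord x) (ord y) <= ord (x + y);
  entourage_ord_subproof : entourage =
    filter_from [set: int]
      (fun k => [set xy : K * K | xy.1 = xy.2 \/ k <= ord (xy.1 - xy.2)])
}.

#[short(type="valuedFieldType")]
HB.structure Definition ValuedField :=
  {K of GRing.Field K & Uniform K & Uniform_isValued K}.

HB.instance Definition _ (K : valuedFieldType) := isPointed.Build K 0.

Section ValuedFieldTheory.
Variable K : valuedFieldType.
Implicit Types x y : K.

Lemma ordM x y : x != 0 -> y != 0 -> ord (x * y) = ord x + ord y.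
Proof. exact: ordM_subproof. Qed.

Lemma ordD x y : x != 0 -> y != 0 -> x + y != 0 ->
  Order.min (ord x) (ord y) <= ord (x + y).
Proof. exact: ordD_subproof. Qed.

Lemma entourage_ord : @entourage K =
  filter_from [set: int]
    (fun k => [set xy : K * K | xy.1 = xy.2 \/ k <= ord (xy.1 - xy.2)]).
Proof. exact: entourage_ord_subproof. Qed.

End ValuedFieldTheory.

(* [iota] identifies [K] with the completion of [F] at [p], and [val_ring K] below
   with the completion of [O_F]: [K] is complete, [iota] has dense image and [ord]
   restricts to the [p]-adic valuation, the
   valuation of a nonzero [a] in [O_F] being the largest [k] with [a] in the
   ideal power [p ^ k]. *)
Definition is_completion (F : fieldExtType rat)
    (p : prime_idealr (ring_of_integers F)) (K : valuedFieldType)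
    (iota : {rmorphism F -> K}) : Prop :=
  (forall (a : ring_of_integers F) (k : nat), a != 0 ->
     (k%:Z <= ord (iota (val a))) <-> ideal_exp p k a)
  /\ dense (range iota)
  /\ (forall A : set_system K, ProperFilter A -> cauchy A -> cvg A).

Section ValuationRing.
Context {K : valuedFieldType}.

Definition val_ring : {pred K} := fun x => (x == 0) || (0 <= ord x).

Definition val_unit : {pred K} := fun x => (x != 0) && (ord x == 0).

Lemma ord1 : ord (1 : K) = 0.
Proof.
by apply: (addrI (ord (1 : K))); rewrite -ordM ?oner_eq0// mulr1 addr0.
Qed.

Lemma ordN1 : ord (- 1 : K) = 0.
Proof.
have n10 : (- 1 : K) != 0 by rewrite oppr_eq0 oner_eq0.
have : ord (- 1 : K) + ord (- 1 : K) = 0 by rewrite -ordM// mulrNN mulr1 ord1.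
by move/eqP; rewrite -mulr2n mulrn_eq0 /= => /eqP.
Qed.

Lemma ordV (x : K) : x != 0 -> ord x^-1 = - ord x.
Proof.
move=> x0; apply/eqP; rewrite -addr_eq0 -(ordM (invr_neq0 x0) x0).
by rewrite mulVf// ord1.
Qed.

Lemma val_ring_subring_closed : subring_closed val_ring.
Proof.
have M : {in val_ring &, forall x y, x * y \in val_ring}.
  move=> x y; rewrite !unfold_in.
  have [->|x0] := eqVneq x 0; first by rewrite mul0r eqxx.
  have [->|y0] := eqVneq y 0; first by rewrite mulr0 eqxx.
  by rewrite /= ordM// mulf_eq0 (negbTE x0) (negbTE y0) /=; exact: addr_ge0.
have N1 : -1 \in val_ring by rewrite unfold_in ordN1 lexx orbT.
split=> //; first by rewrite unfold_in ord1 lexx orbT.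
move=> x y xO yO; have := M _ _ N1 yO; rewrite mulN1r; move: (- y) => z.
move: xO; rewrite !unfold_in.
have [->|x0] := eqVneq x 0; first by rewrite add0r.
have [->|z0] := eqVneq z 0; first by rewrite addr0 (negbTE x0).
have [//|xz0] := eqVneq (x + z) 0.
move=> /= hx hz; apply: le_trans (ordD x0 z0 xz0).
by rewrite le_min hx hz.
Qed.

HB.instance Definition _ :=
  GRing.isSubringClosed.Build K val_ring val_ring_subring_closed.

End ValuationRing.
Arguments val_ring : clear implicits.
Arguments val_unit : clear implicits.

Section SquareClasses.
Variable K : valuedFieldType.

Definition nonzero := {x : K | x != 0}.

Definition nz_mul (x y : nonzero) : nonzero :=
  exist _ (val x * val y) (mulf_neq0 (valP x) (valP y)).

Lemma nz_expz_subproof (x : nonzero) (k : int) : val x ^ k != 0.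
Proof. exact: expfz_neq0 (valP x). Qed.

Definition nz_expz (x : nonzero) (k : int) : nonzero :=
  exist _ (val x ^ k) (nz_expz_subproof x k).

Definition sqcl_rel (x y : nonzero) : bool :=
  `[< exists2 w, w \in val_unit K & val y = val x * w ^+ 2 >].

Lemma sqcl_rel_refl : reflexive sqcl_rel.
Proof.
move=> x; apply/asboolP; exists 1; last by rewrite expr1n mulr1.
by rewrite unfold_in oner_eq0 ord1 eqxx.
Qed.

Lemma sqcl_rel_sym : symmetric sqcl_rel.
Proof.
have S x y : sqcl_rel x y -> sqcl_rel y x.
  move=> /asboolP[w]; rewrite unfold_in => /andP[w0 /eqP ow] yE.
  apply/asboolP; exists w^-1.
    by rewrite unfold_in invr_eq0 w0 ordV// ow oppr0 eqxx.
  by rewrite yE -mulrA -exprMn mulfV// expr1n mulr1.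
by move=> x y; apply/idP/idP; exact: S.
Qed.

Lemma sqcl_rel_trans : transitive sqcl_rel.
Proof.
move=> y x z /asboolP[w]; rewrite unfold_in => /andP[w0 /eqP ow] yE.
move=> /asboolP[t]; rewrite unfold_in => /andP[t0 /eqP ot] zE.
apply/asboolP; exists (w * t); last by rewrite zE yE exprMn -[LHS]mulrA.
by rewrite unfold_in mulf_neq0// ordM// ow ot addr0 eqxx.
Qed.

Canonical sqcl_equiv :=
  EquivRel sqcl_rel sqcl_rel_refl sqcl_rel_sym sqcl_rel_trans.

Definition SqCl := {eq_quot sqcl_equiv}.

Definition sqcl (x : nonzero) : SqCl := \pi_SqCl x.

Definition sqcl_ord (S : SqCl) : int := ord (val (repr S)).

Definition sqcl_mul (S T : SqCl) : SqCl := sqcl (nz_mul (repr S) (repr T)).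

Definition sqcl_expz (S : SqCl) (k : int) : SqCl :=
  sqcl (nz_expz (repr S) k).

(* In odd rank [h_n] is the ideal [2 O_F], so that its valuation is [ord 2]. *)
Definition normalized_rep (pi S : SqCl) : SqCl :=
  sqcl_mul S (sqcl_expz pi (ord (2 : K) - sqcl_ord S)).

End SquareClasses.

Definition sym_mx {K : nzRingType} {n : nat} : {pred 'M[K]_n} :=
  fun A => A^T == A.

Record symmx (K : nzRingType) (n : nat) :=
  SymMx { symmx_val :> 'M[K]_n; symmx_sym : symmx_val \in sym_mx }.

HB.instance Definition _ (K : nzRingType) n := [isSub for @symmx_val K n].
HB.instance Definition _ (K : nzRingType) n := [Choice of symmx K n by <:].

Lemma sym_mx_zmod_closed (K : nzRingType) n : zmod_closed (@sym_mx K n).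
Proof.
split=> [|A B]; rewrite !unfold_in ?trmx0// => /eqP hA /eqP hB.
by rewrite linearB /= hA hB.
Qed.

HB.instance Definition _ (K : nzRingType) n :=
  GRing.isZmodClosed.Build 'M[K]_n (@sym_mx K n) (@sym_mx_zmod_closed K n).
HB.instance Definition _ (K : nzRingType) n :=
  [SubChoice_isSubZmodule of symmx K n by <:].

HB.instance Definition _ (K : valuedFieldType) n :=
  Uniform.copy (symmx K n) (initial_topology (@symmx_val K n)).
HB.instance Definition _ (K : valuedFieldType) n :=
  isPointed.Build (symmx K n) 0.

Lemma symmx_congr_subproof (K : comNzRingType) n (G : symmx K n) (X : 'M[K]_n) :
  X^T *m G *m X \in sym_mx.
Proof.
by rewrite unfold_in !trmx_mul trmxK (eqP (symmx_sym G)) mulmxA.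
Qed.

Definition symmx_congr (K : comNzRingType) n (G : symmx K n) (X : 'M[K]_n) :
  symmx K n := SymMx (symmx_congr_subproof G X).

(* Makes matrices an instance of the join of topological types and Zmodules. *)
HB.instance Definition _ (K : valuedFieldType) m n :=
  GRing.Zmodule.on 'M[K]_(m, n).

Definition borelType (T : ptopologicalType) := g_sigma_algebraType (@open T).

(* Translation invariance and normalization determine [mu] on Borel sets. *)
Definition is_haar (R : realType) (V : PreTopologicalZmodule.type) (L : set V)
    (mu : set V -> \bar R) : Prop :=
  mu L = 1%E /\
  (forall (x : V) (A : set V), <<s @open V>> A ->
     mu [set x + y | y in A] = mu A).

Definition integral_mx (K : valuedFieldType) (n : nat) : set 'M[K]_n :=
  [set X | X \is a mxOver (val_ring K)].

Definition integral_symmx (K : valuedFieldType) (n : nat) : set (symmx K n) :=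
  [set H | val H \is a mxOver (val_ring K)].

(* [U] runs over the open neighborhoods of [G], along the filter generated by
   the families of all those contained in a given neighborhood of [G]. *)
Definition local_density (R : realType) (K : valuedFieldType) (n : nat)
    (muM : set 'M[K]_n -> \bar R) (muS : set (symmx K n) -> \bar R)
    (G : symmx K n) : R :=
  2^-1 *
  lim ((fun U : set (symmx K n) =>
          fine (muM (@integral_mx K n `&` [set X | U (symmx_congr G X)]))
          / fine (muS U))
       @ within [set U | open U] (powerset_filter_from (nbhs G))).

(* A quadratic form [Q] is represented by its Gram matrix [G], that is
   [Q x = x^T G x]; its Hessian matrix is [2 *: G]. *)
Section QuadraticForms.
Variables (K : valuedFieldType) (n : nat).

Definition hessian (G : symmx K n) : 'M[K]_n := 2 *: val G.

Definition qform := {G : symmx K n | \det (hessian G) != 0}.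

Definition gram (Q : qform) : 'M[K]_n := val (val Q).

Definition qeval (Q : qform) (x : 'cV[K]_n) : K :=
  (x^T *m gram Q *m x) 0 0.

Definition hessian_det (Q : qform) : SqCl K :=
  sqcl (exist _ (\det (hessian (val Q))) (valP Q)).

Definition integer_valued (Q : qform) : Prop :=
  forall x : 'cV[K]_n, x \is a mxOver (val_ring K) -> qeval Q x \in val_ring K.

(* The values generate the unit ideal. *)
Definition primitive (Q : qform) : Prop :=
  integer_valued Q /\
  exists (m : nat) (c : 'I_m -> K) (x : 'I_m -> 'cV[K]_n),
    (forall i, c i \in val_ring K /\ x i \is a mxOver (val_ring K))
    /\ \sum_(i < m) c i * qeval Q (x i) = 1.

(* [1] if [z^2 = a x^2 + b y^2] has a nontrivial solution, [-1] otherwise. *)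
Definition hilbert (a b : K) : int :=
  if `[< exists x y z : K, (x, y, z) != (0, 0, 0)
         /\ z ^+ 2 = a * x ^+ 2 + b * y ^+ 2 >]
  then 1 else -1.

(* [e] is the Hasse invariant computed from a diagonalization of [Q]; it does
   not depend on the diagonalization. *)
Definition is_hasse (Q : qform) (e : int) : Prop :=
  exists (a : 'rV[K]_n) (T : 'M[K]_n),
    [/\ T \in unitmx, T^T *m gram Q *m T = diag_mx a
      & e = \prod_(i < n) \prod_(j < n | (i < j)%N) hilbert (a 0 i) (a 0 j)].

Definition integral_GL (T : 'M[K]_n) : Prop :=
  [/\ T \in unitmx, T \is a mxOver (val_ring K)
    & invmx T \is a mxOver (val_ring K)].

Definition integral_equiv (Q Q' : qform) : bool :=
  `[< exists2 T, integral_GL T & gram Q' = T^T *m gram Q *m T >].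

Lemma integral_equiv_refl : reflexive integral_equiv.
Proof.
move=> Q; apply/asboolP; exists 1%:M; last by rewrite trmx1 mul1mx mulmx1.
by split; rewrite ?unitmx1 ?invmx1// mxOver_scalar ?rpred0 ?rpred1.
Qed.

Lemma integral_equiv_sym : symmetric integral_equiv.
Proof.
have S Q Q' : integral_equiv Q Q' -> integral_equiv Q' Q.
  move=> /asboolP[T [uT iT iV] QE]; apply/asboolP; exists (invmx T).
    by split; rewrite ?unitmx_inv ?invmxK.
  by rewrite QE trmx_inv !mulmxA mulVmx ?unitmx_tr// mul1mx mulmxK.
by move=> Q Q'; apply/idP/idP; exact: S.
Qed.

Lemma integral_equiv_trans : transitive integral_equiv.
Proof.
move=> Q' Q Q'' /asboolP[T [uT iT iV] QE] /asboolP[T' [uT' iT' iV'] QE'].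
apply/asboolP; exists (T *m T'); last by rewrite QE' QE trmx_mul !mulmxA.
split; first by rewrite unitmx_mul uT.
- exact: mxOverM.
- suff -> : invmx (T *m T') = invmx T' *m invmx T by exact: mxOverM.
  have uTT : T *m T' \in unitmx by rewrite unitmx_mul uT.
  apply: (can_inj (mulKmx uTT)); rewrite mulmxV// mulmxA.
  by rewrite mulmxK// mulmxV.
Qed.

Canonical integral_equivalence := EquivRel integral_equiv
  integral_equiv_refl integral_equiv_sym integral_equiv_trans.

Definition local_genus := {eq_quot integral_equivalence}.

End QuadraticForms.

(* Invariants of a local genus are read off any of its representatives. *)
Section LocalSums.
Variables (R : realType) (K : valuedFieldType) (n : nat).
Variables (muM : set 'M[K]_n -> \bar R) (muS : set (symmx K n) -> \bar R).

Definition genus_density (g : local_genus K n) : R :=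
  local_density muM muS (val (repr g)).

Definition primitive_genera (S : SqCl K) : set (local_genus K n) :=
  [set g | primitive (repr g) /\ hessian_det (repr g) = S].

(* For [n] odd and [S] normalized, [primitive_genera S] is a singleton. *)
Definition normalized_density (S : SqCl K) : R :=
  get [set genus_density g | g in primitive_genera S].

Definition Mstar (pi : SqCl K) (e : int) (S : SqCl K) : R :=
  \sum_(g \in primitive_genera S `&` [set g | is_hasse (repr g) e])
    normalized_density (normalized_rep pi S) / genus_density g.

Definition Astar (pi S : SqCl K) : R := Mstar pi 1 S + Mstar pi (-1) S.

Definition Bstar (pi S : SqCl K) : R := Mstar pi 1 S - Mstar pi (-1) S.

End LocalSums.

(* Main.v *)
(** Multiplication of the Gram matrix by the unit u is a bijection from the
    primitive genera of Hessian determinant S to those of determinant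
    u^n S = u S (n is odd).  It preserves local densities: it is an isometry of
    Sym_n(K), and an isometry of an ultrametric group that is a countable union
    of balls preserves Haar measure, since a Haar measure gives all balls of the
    same radius the same mass.  On diagonalizations it sends (a_i) to (u a_i),
    so bimultiplicativity of the Hilbert symbol shows that it multiplies the
    Hasse invariant by (u,u)^(n(n-1)/2), the factors (u,a_i) occurring n-1 times
    each, an even number.

    Bimultiplicativity amounts to the norm group of K(sqrt b) having index at
    most 2.  Every unit is approximated by norms one level of the filtration
    1 + P^j at a time; in residue characteristic 2 there is a single level at
    which the norms only reach the image of d |-> a d^2 + d on the residue field,
    which has index 2.  Finiteness of the residue field follows from the fact
    that lifts to F of residues independent over F_l are independent over Q. *)

From HB Require Import structures.
Require Import Defs.
From mathcomp Require Import all_boot all_order all_algebra all_field.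
From mathcomp Require Import zify ring.
From mathcomp Require Import all_classical all_reals all_analysis.

Set Implicit Arguments.
Unset Strict Implicit.
Unset Printing Implicit Defensive.

Import Order.TTheory GRing.Theory Num.Theory.
Import numFieldNormedType.Exports.

Local Open Scope classical_set_scope.
Local Open Scope ring_scope.

(** * Fractional ideals *)

(** A genus is an element of a quotient and its density is read off a chosen representative, so
    besides scaling the proof needs invariance under change of basis. There the sets of matrices
    measured for [G] and for [T^t G T] correspond under conjugation by [T], again an isometry. The
    normalizing numerator moves with [S]: its squareclass is multiplied by [u] as well, so the same
    invariance applies to it and the summands agree one by one. Multiplying the Hasse invariant by a
    sign either fixes or swaps the two sums over [e = 1] and [e = -1]; their sum is unchanged and
    their difference acquires the sign. Its exponent [n(n-1)/2] has the parity of [(n-1)/2], whence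
    the distinction modulo 4. The completion is known only through completeness, density of [F] and
    the valuation on the integers. A uniformizer comes from the squareclass of valuation 1, the
    countable dense set behind the measure argument from the countability of [F], and the bound on
    the residue field from the degree of [F]. *)

Ltac ord_lia :=
  repeat match goal with
  | H : is_true (_ \in _) |- _ => clear H
  | H : is_true (_ != _) |- _ => clear H
  | H : forall _, _ |- _ => clear H
  | H : is_true _ |- _ => revert H
  | H : _ = _ :> int |- _ => revert H
  end;
  repeat match goal with
  | |- context [@ord ?k ?x] => generalize (@ord k x)
  end;
  intros; lia.

Section FractionalIdeals.
Variable K : valuedFieldType.
Implicit Types (x y : K) (j k : int).

(** The fractional ideal of level [k]. Zero is adjoined by hand, since [ord 0] is unspecified. *)
Definition ordge k : {pred K} := fun x => (x == 0) || (k <= ord x).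

Lemma ordgeE k x : x != 0 -> (x \in ordge k) = (k <= ord x).
Proof. by move=> x0; rewrite unfold_in (negbTE x0). Qed.

Lemma ordge_zmod_closed k : zmod_closed (ordge k).
Proof.
split=> [|x y]; first by rewrite unfold_in eqxx.
have [-> _|x0] := eqVneq x 0.
  rewrite sub0r !unfold_in oppr_eq0; have [//|y0 /=] := eqVneq y 0.
  by rewrite -mulN1r ordM ?oppr_eq0 ?oner_eq0// ordN1 add0r.
have [->|y0] := eqVneq y 0; first by rewrite subr0.
rewrite (ordgeE _ x0) (ordgeE _ y0) => hx hy; rewrite unfold_in.
have [//|xy0 /=] := eqVneq (x - y) 0.
have ny0 : - y != 0 by rewrite oppr_eq0.
apply: le_trans (ordD x0 ny0 xy0); rewrite le_min hx /=.
by rewrite -mulN1r ordM ?oppr_eq0 ?oner_eq0// ordN1 add0r.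
Qed.

HB.instance Definition _ k :=
  GRing.isZmodClosed.Build K (ordge k) (ordge_zmod_closed k).

Lemma ordgeW j k x : j <= k -> x \in ordge k -> x \in ordge j.
Proof.
by rewrite !unfold_in => jk /orP[->//|kx]; apply/orP; right; exact: le_trans kx.
Qed.

Lemma ordgeM j k x y : x \in ordge j -> y \in ordge k -> x * y \in ordge (j + k).
Proof.
have [-> _ _|x0] := eqVneq x 0; first by rewrite mul0r rpred0.
have [-> _ _|y0] := eqVneq y 0; first by rewrite mulr0 rpred0.
by rewrite !ordgeE ?mulf_neq0// ordM//; lia.
Qed.

Lemma ordgeMW j k l x y :
  l <= j + k -> x \in ordge j -> y \in ordge k -> x * y \in ordge l.
Proof. by move=> h hx hy; apply: ordgeW h _; exact: ordgeM. Qed.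

Lemma ordge_ord x : x \in ordge (ord x).
Proof. by rewrite unfold_in lexx orbT. Qed.

Lemma ordge0E x : (x \in val_ring K) = (x \in ordge 0).
Proof. by []. Qed.

Lemma ordge_eq0 x : (forall k : nat, x \in ordge k%:Z) -> x = 0.
Proof.
move=> h; apply/eqP/negPn/negP => x0.
by have := h `|ord x|.+1; rewrite ordgeE//; lia.
Qed.

Lemma ord_expz x k : x != 0 -> ord (x ^ k) = ord x * k.
Proof.
move=> x0.
have H n : ord (x ^+ n) = ord x * n%:Z.
  elim: n => [|n IH]; first by rewrite expr0 Defs.ord1 mulr0.
  by rewrite exprS ordM ?expf_neq0// IH; lia.
case: k => n; first exact: H.
by rewrite NegzE -exprnN ordV ?expf_neq0// H; lia.
Qed.

Lemma ord_exp x n : x != 0 -> ord (x ^+ n) = ord x * n%:Z.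
Proof. by move=> x0; exact: (ord_expz n x0). Qed.

Lemma ordN x : ord (- x) = ord x.
Proof.
have [->|x0] := eqVneq x 0; first by rewrite oppr0.
by rewrite -mulN1r ordM ?oppr_eq0 ?oner_eq0// ordN1 add0r.
Qed.

Lemma ord_eq_ordge k x y : x != 0 -> x - y \in ordge k -> ord x < k ->
  y != 0 /\ ord y = ord x.
Proof.
move=> x0 xy xk.
have y0 : y != 0 by apply/eqP => y0; move: xy; rewrite y0 subr0 ordgeE//; lia.
split=> //; have [h|h|//] := ltgtP (ord y) (ord x).
- have : x - (x - y) \in ordge (ord y + 1).
    by rewrite rpredB// ?(ordgeW _ (ordge_ord x)) ?(ordgeW _ xy)//; lia.
  by rewrite subKr ordgeE//; lia.
- have : x - y + y \in ordge (ord x + 1).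
    by rewrite rpredD// ?(ordgeW _ (ordge_ord y)) ?(ordgeW _ xy)//; lia.
  by rewrite subrK ordgeE//; lia.
Qed.

Lemma unitP x : reflect (x != 0 /\ ord x = 0) (x \in val_unit K).
Proof. by apply: (iffP andP) => -[? /eqP]; split=> //; apply/eqP. Qed.

Lemma unit_neq0 x : x \in val_unit K -> x != 0.
Proof. by case/unitP. Qed.

Lemma unit_ord x : x \in val_unit K -> ord x = 0.
Proof. by case/unitP. Qed.

Lemma unit_ordge0 x : x \in val_unit K -> x \in ordge 0.
Proof. by case/unitP => x0 xo; rewrite ordgeE// xo. Qed.

Lemma unitM x y : x \in val_unit K -> y \in val_unit K -> x * y \in val_unit K.
Proof.
by move=> /unitP[x0 ox] /unitP[y0 oy]; apply/unitP; rewrite mulf_neq0// ordM//; lia.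
Qed.

Lemma unitV x : x \in val_unit K -> x^-1 \in val_unit K.
Proof. by move=> /unitP[x0 ox]; apply/unitP; rewrite invr_neq0// ordV//; lia. Qed.

Lemma unit_congr x y : x \in val_unit K -> x - y \in ordge 1 -> y \in val_unit K.
Proof.
move=> /unitP[x0 ox] h; have [|y0 oy] := ord_eq_ordge x0 h; first lia.
by apply/unitP; rewrite oy.
Qed.

Lemma ordge0_unit x : x \in ordge 0 -> x \notin ordge 1 -> x \in val_unit K.
Proof.
have [->|x0] := eqVneq x 0; first by rewrite !rpred0.
by rewrite !ordgeE// => h h1; apply/unitP; split=> //; lia.
Qed.

Lemma ordge_div x y k : y != 0 -> x \in ordge k -> x / y \in ordge (k - ord y).
Proof.
by move=> y0 hx; apply: ordgeM => //; rewrite ordgeE ?invr_eq0// ordV.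
Qed.

End FractionalIdeals.
Arguments ordge {K}.

(** * Completeness and Hensel lifting *)

Section Completeness.
Variable K : valuedFieldType.
Implicit Types (x y : K) (j k : int).

Lemma ordgeBP k x y : x - y \in ordge k <-> x = y \/ k <= ord (x - y).
Proof.
rewrite unfold_in subr_eq0; split=> [/orP[/eqP|]|[->|->]]; rewrite ?eqxx ?orbT//.
- by left.
- by right.
Qed.

Lemma entourage_ordgeP (A : set (K * K)) :
  entourage A <-> exists k, forall x y, x - y \in ordge k -> A (x, y).
Proof.
rewrite entourage_ord; split=> [[k _ kA]|[k kA]]; exists k => //.
  by move=> x y /ordgeBP h; exact: kA.
by move=> [x y] /ordgeBP; exact: kA.
Qed.

Lemma nbhs_ordgeP x (A : set K) :
  nbhs x A <-> exists k, forall y, x - y \in ordge k -> A y.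
Proof.
rewrite -nbhs_entourageE; split=> [[E /entourage_ordgeP[k kE] EA]|[k kA]].
  by exists k => y /kE xy; apply: EA; apply/xsectionP.
exists [set xy | xy.1 - xy.2 \in ordge k].
  by apply/entourage_ordgeP; exists k.
by move=> y /xsectionP; exact: kA.
Qed.

Hypothesis Kcomplete : forall A : set_system K, ProperFilter A -> cauchy A -> cvg A.

Lemma ordge_telescope (t : nat -> K) (n m : nat) : (n <= m)%N ->
  (forall i, t i.+1 - t i \in ordge i%:Z) -> t m - t n \in ordge n%:Z.
Proof.
move=> nm h; elim: m nm => [|m IH]; first by rewrite leqn0 => /eqP->; rewrite subrr rpred0.
rewrite leq_eqVlt => /orP[/eqP->|]; first by rewrite subrr rpred0.
rewrite ltnS => nm; rewrite -(subrK (t m) (t m.+1)) -addrA rpredD ?IH//.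
by apply: ordgeW (h m); rewrite lez_nat.
Qed.

(** The rate passes to the limit because balls are closed: [l] is compared with [t n] through a term
    of index beyond [n] that is already close to [l]. *)
Lemma ordge_cvg (t : nat -> K) : (forall n, t n.+1 - t n \in ordge n%:Z) ->
  exists l, forall n, l - t n \in ordge n%:Z.
Proof.
move=> ht.
have tc (n i : nat) : (n <= i)%N -> t i - t n \in ordge n%:Z.
  by move=> ni; exact: ordge_telescope.
have : cvg (t @ \oo).
  apply: Kcomplete => A /entourage_ordgeP[k kA].
  exists ([set t i | i in [set i | `|k|%N <= i]%N],
          [set t i | i in [set i | `|k|%N <= i]%N]).
    by split; exists `|k|%N => // i /= ki; exists i.
  move=> [_ _] /= [[i /= ki <-] [j /= kj <-]]; apply: kA.
  rewrite -(subrK (t `|k|%N) (t i)) -addrA rpredD//.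
    by apply: ordgeW (tc _ _ ki); lia.
  by rewrite -opprB rpredN; apply: ordgeW (tc _ _ kj); lia.
move=> /cvg_ex[l tl]; exists l => n.
have /tl[N _ hN] : nbhs l [set y | l - y \in ordge n%:Z].
  by apply/nbhs_ordgeP; exists n.
rewrite -(subrK (t (maxn n N)) l) -addrA rpredD//.
  by apply: hN => /=; exact: leq_maxr.
by apply: tc; exact: leq_maxl.
Qed.

(* [t |-> c - t^2] is a contraction of the maximal ideal. *)
Lemma hensel_artin_schreier (c : K) : c \in ordge 1 -> exists t, t + t ^+ 2 = c.
Proof.
move=> c1; pose t n := iter n (fun t => c - t ^+ 2) 0.
have t1 n : t n \in ordge 1.
  elim: n => [|n IH] /=; first exact: rpred0.
  by rewrite rpredB// expr2; apply: (ordgeMW _ IH IH).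
have ht n : t n.+1 - t n \in ordge n%:Z.
  elim: n => [|n IH]; first by rewrite rpredB//; apply: (ordgeW _ (t1 _)).
  have -> : t n.+2 - t n.+1 = - ((t n.+1 - t n) * (t n.+1 + t n)) by rewrite /t /=; ring.
  by rewrite rpredN; apply: (ordgeMW _ IH (rpredD (t1 _) (t1 _))); lia.
have [l hl] := ordge_cvg ht; exists l; apply/eqP; rewrite -subr_eq0; apply/eqP.
apply: ordge_eq0 => n.
have l0 : l \in ordge 0 by rewrite -(subr0 l); exact: (hl 0%N).
have t0 m : t m \in ordge 0 by apply: ordgeW (t1 m).
have -> : l + l ^+ 2 - c = (l - t n.+1) + (l - t n) * (l + t n) by rewrite /t /=; ring.
rewrite rpredD//; first by apply: ordgeW (hl n.+1); lia.
by apply: (ordgeMW _ (hl n) (rpredD l0 (t0 n))); lia.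
Qed.

(** Writing [x = 1 + 4 c] with [c] in the maximal ideal, the equation [(1 + 2 t)^2 = x] becomes the
    Artin-Schreier equation [t + t^2 = c]. The bound [1 + 2 ord 2] is the valuation that division by
    4 brings down to 1. *)
Lemma square_near1 (x : K) : (2 : K) != 0 -> x - 1 \in ordge (1 + 2 * ord (2 : K)) ->
  exists y, x = y ^+ 2.
Proof.
move=> two0 hx.
have four0 : (2 ^+ 2 : K) != 0 by rewrite expf_neq0.
have := ordge_div four0 hx; rewrite ord_exp//.
have -> : 1 + 2 * ord (2 : K) - ord (2 : K) * 2%N = 1 by lia.
move=> /hensel_artin_schreier[t ht]; exists (1 + 2 * t).
have -> : (1 + 2 * t) ^+ 2 = 1 + 2 ^+ 2 * (t + t ^+ 2) by ring.
by rewrite ht mulrC divfK//; ring.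
Qed.

End Completeness.

(** * The residue field *)

Local Close Scope classical_set_scope.

Section Counting.
Variables (T : finType) (f s t : T -> T) (D : {set T}).
Hypothesis fib : forall x y, x \in D -> y \in D -> f x = f y -> y = x \/ y = s x.

Lemma leq_card_two_to_one : (#|D| <= 2 * #|f @: D|)%N.
Proof.
rewrite -sum1_card (partition_big f (mem (f @: D))) /=; last first.
  by move=> x xD; apply/imsetP; exists x.
rewrite mulnC -sum_nat_const; apply: leq_sum => y /imsetP[x xD ->].
rewrite sum1_card; apply: leq_trans (_ : (#|[set x; s x]| <= 2)%N).
  apply: subset_leq_card; apply/fintype.subsetP => z; rewrite !inE => /andP[zD /eqP/esym fz].
  by have [->|->] := fib xD zD fz; rewrite eqxx ?orbT.
by rewrite cards2; case: (_ == _).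
Qed.

(** The image [f(D)] has at least half the size of [D], and so has its disjoint copy [t(f(D))];
    together they fill [D]. This expresses that a subgroup has index at most 2 without forming a
    group. *)
Lemma two_to_one_cover : injective t -> f @: D \subset D -> t @: D \subset D ->
  (forall x y, x \in D -> y \in D -> t (f x) <> f y) ->
  forall z, z \in D -> (exists2 x, x \in D & z = f x) \/
                       (exists2 x, x \in D & z = t (f x)).
Proof.
move=> tinj fD tD disj z zD; set A := f @: D.
have dis : A :&: t @: A = finset.set0.
  apply/finset.setP => w; rewrite !inE; apply/negbTE/negP.
  move=> /andP[/imsetP[y yD ->] /imsetP[_ /imsetP[x xD ->]]] /esym.
  exact: disj.
have cA : #|A :|: t @: A| = (2 * #|A|)%N.
  by rewrite cardsU dis cards0 subn0 card_imset// mul2n addnn.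
have sA : A :|: t @: A \subset D.
  by rewrite finset.subUset fD (fintype.subset_trans (imsetS t fD) tD).
have /eqP AE : A :|: t @: A == D by rewrite eqEcard sA cA leq_card_two_to_one.
have : z \in A :|: t @: A by rewrite AE.
rewrite inE => /orP[/imsetP[x xD ->]|/imsetP[_ /imsetP[x xD ->] ->]].
  by left; exists x.
by right; exists x.
Qed.

End Counting.

(** The residue field enters only through an irredundant system of representatives, so that maps on
    it become maps on ['I_q]. *)
Definition finite_residue (K : valuedFieldType) : Prop :=
  exists (q : nat) (r : 'I_q -> K),
    [/\ forall i, r i \in ordge 0,
        forall x, x \in ordge 0 -> exists i, x - r i \in ordge 1
      & forall i j, r i - r j \in ordge 1 -> i = j].

Section ResidueField.
Variable K : valuedFieldType.
Implicit Types (x y : K) (j k : int).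

Lemma residue_map : finite_residue K -> exists (q : nat) (r : 'I_q -> K) (res : K -> 'I_q),
  [/\ forall i, r i \in ordge 0,
      forall x, x \in ordge 0 -> r (res x) - x \in ordge 1,
      forall x y, x \in ordge 0 -> y \in ordge 0 -> res x = res y -> x - y \in ordge 1,
      forall x y, x \in ordge 0 -> y \in ordge 0 -> x - y \in ordge 1 -> res x = res y
    & cancel r res].
Proof.
move=> [q [r [r0 rsurj rinj]]].
have [res hres] : exists res : K -> 'I_q, forall x, x \in ordge 0 -> r (res x) - x \in ordge 1.
  suff /choice[res hres] : forall x, exists i, x \in ordge 0 -> r i - x \in ordge 1.
    by exists res.
  move=> x; have [x0|/negP x0] := boolP (x \in ordge 0); last first.
    by have [i _] := rsurj 0 (rpred0 _); exists i.
  by have [i hi] := rsurj x x0; exists i => _; rewrite -opprB rpredN.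
have resE x y : x \in ordge 0 -> y \in ordge 0 -> x - y \in ordge 1 -> res x = res y.
  move=> x0 y0 xy; apply: rinj.
  have -> : r (res x) - r (res y) = (r (res x) - x) - (r (res y) - y) + (x - y) by ring.
  by rewrite rpredD// rpredB// hres.
exists q, r, res; split=> // [x y x0 y0 xy|i]; last by apply: rinj; exact: hres.
have -> : x - y = (r (res y) - y) - (r (res x) - x) by rewrite xy; ring.
by rewrite rpredB// hres.
Qed.

Lemma ordge0M x y : x \in ordge 0 -> y \in ordge 0 -> x * y \in ordge 0.
Proof. by move=> hx hy; exact: (ordgeMW _ hx hy). Qed.

Lemma ordge0Ml k x y : x \in ordge 0 -> y \in ordge k -> x * y \in ordge k.
Proof. by move=> hx hy; apply: (ordgeMW _ hx hy); rewrite add0r. Qed.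

Lemma ordge0Mr k x y : x \in ordge k -> y \in ordge 0 -> x * y \in ordge k.
Proof. by move=> hx hy; apply: (ordgeMW _ hx hy); rewrite addr0. Qed.

Lemma ordge0X x n : x \in ordge 0 -> x ^+ n \in ordge 0.
Proof.
move=> x0; elim: n => [|n IH]; last by rewrite exprS ordge0M.
by rewrite expr0 ordgeE ?oner_neq0// Defs.ord1.
Qed.

Lemma ordge0_1 : (1 : K) \in ordge 0.
Proof. by rewrite -(expr0 (0 : K)) ordge0X// rpred0. Qed.

Lemma ordge1_cancel x y : x \in val_unit K -> x * y \in ordge 1 -> y \in ordge 1.
Proof.
move=> ux xy; rewrite -[y](mulKf (unit_neq0 ux)); apply: ordge0Ml => //.
exact/unit_ordge0/unitV.
Qed.

Lemma ordge1_mul_eq0 x y : x \in ordge 0 -> x * y \in ordge 1 -> x \in ordge 1 \/ y \in ordge 1.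
Proof.
move=> x0 xy; have [|x1] := boolP (x \in ordge 1); first by left.
by right; apply: ordge1_cancel xy; exact: ordge0_unit.
Qed.

Lemma ordge1W x : x \in ordge 1 -> x \in ordge 0.
Proof. exact: ordgeW. Qed.

Hypothesis Kfin : finite_residue K.

Definition residue_square (c : K) := exists2 d, d \in ordge 0 & d ^+ 2 - c \in ordge 1.

(** Frobenius is injective on a field of characteristic 2, hence bijective on a finite one. *)
Lemma residue_square2 c : (2 : K) \in ordge 1 -> c \in ordge 0 -> residue_square c.
Proof.
move=> two c0; have [q [r [res [r0 rres res1 resE rK]]]] := residue_map Kfin.
have rr i : r i ^+ 2 \in ordge 0 by exact: ordge0X.
have finj : injective (fun i => res (r i ^+ 2)).
  move=> i j /(res1 _ _ (rr i) (rr j)) h; rewrite -[i]rK -[j]rK; apply: resE => //.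
  have : (r i - r j) * (r i - r j) \in ordge 1.
    have -> : (r i - r j) * (r i - r j) =
      (r i ^+ 2 - r j ^+ 2) + 2 * (r j * (r j - r i)) by ring.
    by rewrite rpredD// ordge0Mr// ordge0M// rpredB.
  by move=> /ordge1_mul_eq0[]//; rewrite rpredB.
have [g gK gK'] := injF_bij finj.
exists (r (g (res c))) => //.
by apply: res1 => //; exact: gK'.
Qed.

Definition residue_AS (a b c : K) :=
  exists2 d, d \in ordge 0 & a * d ^+ 2 + b * d - c \in ordge 1.

(* An additive map with kernel of order 2 has image of index 2. *)
Lemma residue_AS_index2 a b c c' : (2 : K) \in ordge 1 ->
  a \in val_unit K -> b \in val_unit K -> c \in ordge 0 -> c' \in ordge 0 ->
  [\/ residue_AS a b c, residue_AS a b c' | residue_AS a b (c + c')].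
Proof.
move=> two ua ub c0 c'0; have [q [r [res [r0 rres res1 resE rK]]]] := residue_map Kfin.
have [?|nc] := pselect (residue_AS a b c); first by constructor 1.
have a0 := unit_ordge0 ua; have b0 := unit_ordge0 ub.
pose g x := a * x ^+ 2 + b * x.
have g0 x : x \in ordge 0 -> g x \in ordge 0 by move=> x0; rewrite rpredD// ordge0M// ordge0X.
pose f i := res (g (r i)); pose s i := res (- (b / a) - r i).
pose t i := res (r i + c).
have ba0 : b / a \in ordge 0 by rewrite ordge0M// unit_ordge0// unitV.
have fib (x y : 'I_q) : x \in [set: 'I_q] -> y \in [set: 'I_q] -> f x = f y -> y = x \/ y = s x.
  move=> _ _ /(res1 _ _ (g0 _ (r0 x)) (g0 _ (r0 y))).
  have -> : g (r x) - g (r y) = (r x - r y) * (a * (r x + r y + b / a)).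
    have -> : a * (r x + r y + b / a) = a * r x + a * r y + b.
      by rewrite !mulrDr [a * (b / a)]mulrC divfK// unit_neq0.
    by rewrite /g; ring.
  move=> /ordge1_mul_eq0[|h|h]; first by rewrite rpredB.
    by left; rewrite -[x]rK -[y]rK; apply/esym/resE.
  right; rewrite -[y]rK; apply: resE => //; first by rewrite rpredB ?rpredN.
  have -> : r y - (- (b / a) - r x) = r x + r y + b / a by ring.
  exact: ordge1_cancel ua h.
have tinj : injective t.
  move=> i j /res1 h; rewrite -[i]rK -[j]rK; apply: resE => //.
  by have := h (rpredD (r0 i) c0) (rpredD (r0 j) c0); rewrite opprD addrACA subrr addr0.
have sub (h : 'I_q -> 'I_q) : h @: [set: 'I_q] \subset [set: 'I_q] by exact: finset.subsetT.
have disj (x y : 'I_q) : x \in [set: 'I_q] -> y \in [set: 'I_q] -> t (f x) <> f y.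
  move=> _ _ /res1 h; apply: nc; exists (r y - r x); first by rewrite rpredB.
  have {}h := h (rpredD (r0 _) c0) (g0 _ (r0 y)).
  have -> : a * (r y - r x) ^+ 2 + b * (r y - r x) - c =
    (r (f x) - g (r x)) - (r (f x) + c - g (r y)) + 2 * (a * r x * (r x - r y)).
    by rewrite /g; ring.
  rewrite rpredD//; last by rewrite ordge0Mr// ordge0M ?ordge0M ?rpredB.
  by rewrite rpredB// rres// g0.
have [[i _ /res1 h]|[i _ /res1 h]] := two_to_one_cover fib tinj (sub _) (sub _) disj
  (finset.in_setT (res c')).
  constructor 2; exists (r i) => //.
  by rewrite -opprB rpredN; apply: h => //; exact: g0.
constructor 3; exists (r i) => //.
have {}h := h c'0 (rpredD (r0 _) c0).
have -> : a * r i ^+ 2 + b * r i - (c + c') =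
  - (r (f i) - g (r i)) - (c' - (r (f i) + c)) - 2 * c by rewrite /g; ring.
by rewrite rpredB ?ordge0Mr// rpredB// rpredN rres// g0.
Qed.

(** Squaring on the nonzero residues has fibres [{x, -x}]. If [v] is not a square, the squares and
    their multiples by [v] are disjoint, so they exhaust the nonzero residues. *)
Lemma residue_square_index2 v w : v \in val_unit K -> w \in val_unit K ->
  [\/ residue_square v, residue_square w | residue_square (v * w)].
Proof.
move=> uv uw; have [q [r [res [r0 rres res1 resE rK]]]] := residue_map Kfin.
have [?|nv] := pselect (residue_square v); first by constructor 1.
have v0 := unit_ordge0 uv; have w0 := unit_ordge0 uw.
pose D := [set i | r i \in val_unit K].
have rD i : i \in D -> r i \in val_unit K by rewrite inE.
have resD x : x \in val_unit K -> res x \in D.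
  move=> ux; rewrite inE; apply: (unit_congr ux).
  by rewrite -opprB rpredN rres// unit_ordge0.
pose f i := res (r i ^+ 2); pose s i := res (- r i); pose t i := res (v * r i).
have u2 i : i \in D -> r i ^+ 2 \in val_unit K by move=> /rD h; rewrite expr2 unitM.
have fib (x y : 'I_q) : x \in D -> y \in D -> f x = f y -> y = x \/ y = s x.
  move=> xD yD /(res1 _ _ (unit_ordge0 (u2 _ xD)) (unit_ordge0 (u2 _ yD))).
  rewrite subr_sqr => /ordge1_mul_eq0[|h|h]; first by rewrite rpredB.
    by left; rewrite -[x]rK -[y]rK; apply/esym/resE.
  by right; rewrite -[y]rK; apply: resE; rewrite ?rpredN// opprK addrC.
have tinj : injective t.
  move=> i j /res1 h; rewrite -[i]rK -[j]rK; apply: resE => //.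
  by apply: ordge1_cancel uv _; rewrite mulrBr; apply: h; exact: ordge0M.
have fD : f @: D \subset D by apply/fintype.subsetP => _ /imsetP[i iD ->]; exact/resD/u2.
have tD : t @: D \subset D.
  by apply/fintype.subsetP => _ /imsetP[i /rD iD ->]; apply/resD; exact: unitM.
have disj (x y : 'I_q) : x \in D -> y \in D -> t (f x) <> f y.
  move=> xD yD /res1 h; apply: nv; exists (r y / r x).
    by rewrite ordge0M// unit_ordge0// unitV// rD.
  have {}h := h (ordge0M v0 (r0 _)) (unit_ordge0 (u2 _ yD)).
  apply: (ordge1_cancel (u2 _ xD)).
  have -> : r x ^+ 2 * ((r y / r x) ^+ 2 - v) =
    v * (r (f x) - r x ^+ 2) - (v * r (f x) - r y ^+ 2).
    have rx0 := unit_neq0 (rD _ xD).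
    rewrite mulrBr expr_div_n [_ * (_ / _)]mulrC divfK ?expf_neq0//; ring.
  by rewrite rpredB// ordge0Ml// rres// ordge0X.
have [[i iD /res1 h]|[i iD /res1 h]] := two_to_one_cover fib tinj fD tD disj (resD _ uw).
  constructor 2; exists (r i) => //.
  by rewrite -opprB rpredN; apply: h => //; exact: ordge0X.
constructor 3; exists (v * r i); first exact: ordge0M.
have {}h := h w0 (ordge0M v0 (r0 _)).
have -> : (v * r i) ^+ 2 - v * w =
  - (v * (v * (r (f i) - r i ^+ 2))) - v * (w - v * r (f i)) by ring.
by rewrite rpredB ?rpredN ?ordge0Ml// rres// ordge0X.
Qed.

(* Pigeonhole: both [s |-> s^2] and [y |-> v + b y^2] take more than half of the
   residue classes as values. *)
Lemma residue_norm_surj b v : b \in val_unit K -> v \in ordge 0 ->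
  exists s y, [/\ s \in ordge 0, y \in ordge 0 & s ^+ 2 - b * y ^+ 2 - v \in ordge 1].
Proof.
move=> ub v0; have [q [r [res [r0 rres res1 resE rK]]]] := residue_map Kfin.
have b0 := unit_ordge0 ub.
pose f i := res (r i ^+ 2); pose g i := res (v + b * r i).
have g0 i : v + b * r i \in ordge 0 by rewrite rpredD// ordge0M.
have r2 i : r i ^+ 2 \in ordge 0 by exact: ordge0X.
have fib (x y : 'I_q) : x \in [set: _] :\ res 0 -> y \in [set: _] :\ res 0 ->
    f x = f y -> y = x \/ y = res (- r x).
  move=> _ _ /(res1 _ _ (r2 x) (r2 y)).
  rewrite subr_sqr => /ordge1_mul_eq0[|h|h]; first by rewrite rpredB.
    by left; rewrite -[x]rK -[y]rK; apply/esym/resE.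
  by right; rewrite -[y]rK; apply: resE; rewrite ?rpredN// opprK addrC.
have ginj : injective g.
  move=> i j /(res1 _ _ (g0 i) (g0 j)); rewrite opprD addrACA subrr add0r -mulrBr.
  by move=> /(ordge1_cancel ub) h; rewrite -[i]rK -[j]rK; exact: resE.
pose A := f @: [set: _].
(* The nonzero classes have at least [(q - 1) / 2] squares; the class of 0, itself a square, makes
   this more than [q / 2]. *)
have qA : (q < 2 * #|A|)%N.
  have h := leq_card_two_to_one fib.
  have cD : #|[set: _] :\ res 0| = q.-1.
    by rewrite cardsDS ?finset.subsetT// cardsT card_ord cards1 subn1.
  have fA : res 0 \in A.
    apply/imsetP; exists (res 0) => //; apply: resE; rewrite ?rpred0// add0r rpredN.
    rewrite expr2 ordge0Ml//.
    by rewrite -[X in X \in _]subr0 rres// rpred0.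
  have sA : f @: ([set: _] :\ res 0) \subset A :\ res 0.
    apply/fintype.subsetP => z /imsetP[i]; rewrite !inE andbT => ni ->.
    apply/andP; split; last by apply/imsetP; exists i.
    apply/eqP => /res1; rewrite subr0 => /(_ (r2 i) (rpred0 _)); rewrite expr2.
    move=> hi; have h1 : r i \in ordge 1 by case: (ordge1_mul_eq0 (r0 i) hi).
    by move/eqP: ni; apply; rewrite -[i]rK; apply: resE; rewrite ?rpred0// subr0.
  have := subset_leq_card sA; have := cardsD1 (res 0) A; rewrite fA.
  move: h; rewrite cD; have := ltn_ord (res 0); lia.
have /existsP[z] : [exists z, (z \in A) && (z \in g @: A)].
  apply: contraT => /existsPn h.
  have dis : A :&: g @: A = finset.set0.
    apply/finset.setP => w; rewrite !inE; exact/negbTE/h.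
  have := max_card (A :|: g @: A).
  by rewrite cardsU dis cards0 subn0 card_imset// card_ord; lia.
move=> /andP[/imsetP[i _ ->] /imsetP[_ /imsetP[j _ ->]]].
move=> /(res1 _ _ (r2 i) (g0 _)) h; exists (r i), (r j); split=> //.
have -> : r i ^+ 2 - b * r j ^+ 2 - v =
  r i ^+ 2 - (v + b * r (f j)) + b * (r (f j) - r j ^+ 2) by ring.
by rewrite rpredD// ordge0Ml// rres.
Qed.

End ResidueField.

Local Open Scope classical_set_scope.

(** * The norm group of a quadratic extension has index at most 2 *)

Definition is_norm (K : valuedFieldType) (b x : K) :=
  exists z y, x = z ^+ 2 - b * y ^+ 2.

Section NormGroup.
Variable K : valuedFieldType.
Implicit Types (x y b : K) (i j k : int).

Lemma is_normM b x y : is_norm b x -> is_norm b y -> is_norm b (x * y).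
Proof.
move=> [z [t ->]] [z' [t' ->]].
by exists (z * z' + b * t * t'), (z * t' + t * z'); ring.
Qed.

Lemma is_norm_square b x : is_norm b (x ^+ 2).
Proof. by exists x, 0; ring. Qed.

Lemma is_norm_cancel b x y : x != 0 -> is_norm b x -> is_norm b (x * y) -> is_norm b y.
Proof.
move=> x0 hx hxy; have -> : y = (x * y) * x * x^-1 ^+ 2 by field.
by apply: is_normM; [exact: is_normM|exact: is_norm_square].
Qed.

Lemma is_norm_mul_square b c x : c != 0 -> is_norm (b * c ^+ 2) x -> is_norm b x.
Proof. by move=> c0 [z [y ->]]; exists z, (c * y); ring. Qed.

Lemma is_normN b : is_norm b (- b).
Proof. by exists 0, 1; ring. Qed.

Lemma int_parity (k : int) : exists m, k = 2 * m \/ k = 2 * m + 1.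
Proof.
exists (k %/ 2)%Z; have := divz_eq k 2; have := modz_ge0 k (isT : (2 : int) != 0).
by have := ltz_pmod k (isT : 0 < (2 : int)); lia.
Qed.

Lemma unit_div_near1 k x y : x \in val_unit K -> y - x \in ordge k -> y / x - 1 \in ordge k.
Proof.
move=> ux h; have -> : y / x - 1 = (y - x) / x.
  by rewrite mulrBl divff// unit_neq0.
by apply: ordge0Mr => //; exact/unit_ordge0/unitV.
Qed.

Hypothesis two0 : (2 : K) != 0.
Hypothesis Kcomplete : forall A : set_system K, ProperFilter A -> cauchy A -> cvg A.
Hypothesis Kfin : finite_residue K.
Variable p : K.
Hypothesis p0 : p != 0.
Hypothesis ord_p : ord p = 1.

Local Notation e := (ord (2 : K)).

Lemma exists_ord i : exists2 q : K, q != 0 & ord q = i.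
Proof. by exists (p ^ i); rewrite ?expfz_neq0// ord_expz// ord_p mul1r. Qed.

Lemma ord2_ge0 : 0 <= e.
Proof. by rewrite -ordgeE// -[2]/(1 + 1) rpredD// ordge0_1. Qed.

Lemma is_norm_near1 b x : x - 1 \in ordge (1 + 2 * e) -> is_norm b x.
Proof. by move=> /(square_near1 Kcomplete two0)[y ->]; exact: is_norm_square. Qed.

(** A norm of odd valuation and the squares together realize every valuation, so each element is a
    norm times a unit and the question concerns units only. *)
Lemma norm_index2_of_odd b :
  (exists t, [/\ is_norm b t, t != 0 & exists m, ord t = 2 * m + 1]) ->
  (forall x y, x \in val_unit K -> y \in val_unit K ->
     [\/ is_norm b x, is_norm b y | is_norm b (x * y)]) ->
  forall x y, x != 0 -> y != 0 -> [\/ is_norm b x, is_norm b y | is_norm b (x * y)].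
Proof.
move=> [t [Nt t0 [m ot]]] U2 x y x0 y0.
have dec z : z != 0 -> exists g, [/\ is_norm b g, g != 0 & z / g \in val_unit K].
  move=> z0; have [l [oz|oz]] := int_parity (ord z).
    have [q q0 oq] := exists_ord l; exists (q ^+ 2).
    split; [exact: is_norm_square|by rewrite expf_neq0|].
    apply/unitP; rewrite mulf_neq0 ?invr_neq0 ?expf_neq0//; split=> //.
    by rewrite ordM ?invr_neq0 ?expf_neq0// ordV ?expf_neq0// ord_exp// oz oq; ord_lia.
  have [q q0 oq] := exists_ord (l - m); exists (t * q ^+ 2).
  split; [exact/is_normM/is_norm_square|by rewrite mulf_neq0// expf_neq0|].
  apply/unitP; rewrite mulf_neq0 ?invr_neq0 ?mulf_neq0 ?expf_neq0//; split=> //.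
  rewrite ordM ?invr_neq0 ?mulf_neq0 ?expf_neq0// ordV ?mulf_neq0 ?expf_neq0//.
  by rewrite ordM ?expf_neq0// ord_exp// oz oq ot; ord_lia.
have [g [Ng g0 ug]] := dec x x0; have [h [Nh h0 uh]] := dec y y0.
rewrite -(divfK g0 x) -(divfK h0 y); set v := x / g; set w := y / h.
have [Nv|Nw|Nvw] := U2 _ _ ug uh.
- by constructor 1; exact: is_normM.
- by constructor 2; exact: is_normM.
- constructor 3; rewrite mulrACA; apply: is_normM => //; exact: is_normM.
Qed.

(** When every unit is a norm, so is every element of even valuation, and two elements of odd
    valuation have a product of even valuation. *)
Lemma norm_index2_of_units b :
  (forall x, x \in val_unit K -> is_norm b x) ->
  forall x y, x != 0 -> y != 0 -> [\/ is_norm b x, is_norm b y | is_norm b (x * y)].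
Proof.
move=> Nu x y x0 y0.
have ev m z : z != 0 -> ord z = 2 * m -> is_norm b z.
  move=> z0 oz; have [q q0 oq] := exists_ord m.
  rewrite -[z](divfK (_ : q ^+ 2 != 0)) ?expf_neq0//; apply: is_normM; last exact: is_norm_square.
  apply: Nu; apply/unitP; rewrite mulf_neq0 ?invr_neq0 ?expf_neq0//; split=> //.
  by rewrite ordM ?invr_neq0 ?expf_neq0// ordV ?expf_neq0// ord_exp// oz oq; ord_lia.
have [m [ox|ox]] := int_parity (ord x); first by constructor 1; exact: ev ox.
have [l [oy|oy]] := int_parity (ord y); first by constructor 2; exact: ev oy.
by constructor 3; apply: (ev (m + l + 1)); rewrite ?mulf_neq0// ordM// ox oy; ord_lia.
Qed.

(** Norms fill the graded piece of the unit filtration at level [j]. *)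
Definition norm_step b j := forall w, w \in val_unit K -> w - 1 \in ordge j ->
  exists2 h, is_norm b h & w - h \in ordge (j + 1).

Lemma norm_approx b (j : int) (n : nat) : 0 <= j ->
  (forall i, j <= i < j + n -> norm_step b i) ->
  forall w, w \in val_unit K -> w - 1 \in ordge j -> exists h w',
    [/\ h \in val_unit K, is_norm b h, w = h * w', w' \in val_unit K
      & w' - 1 \in ordge (j + n)].
Proof.
move=> j0; elim: n => [|n IH] hstep w uw hw.
  have u1 : (1 : K) \in val_unit K by apply/unitP; rewrite oner_neq0 Defs.ord1.
  exists 1, w; rewrite mul1r addr0; split=> //.
  by rewrite -(expr1n K 2); exact: is_norm_square.
have [i hi|h [w' [uh Nh -> uw' hw']]] := IH _ w uw hw; first by apply: hstep; ord_lia.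
have [|g Ng wg] := hstep (j + n) _ w' uw' hw'; first by ord_lia.
have ug : g \in val_unit K by apply: (unit_congr uw'); apply: ordgeW wg; ord_lia.
exists (h * g), (w' / g); split.
- exact: unitM.
- exact: is_normM.
- by rewrite -mulrA [g * _]mulrC divfK// unit_neq0.
- by rewrite unitM// unitV.
- by apply: (unit_div_near1 ug); apply: ordgeW wg; ord_lia.
Qed.

(** * Residue characteristic 2: norms along the unit filtration *)

Hypothesis e1 : 1 <= e.

Lemma two_ordge1 : (2 : K) \in ordge 1.
Proof. by rewrite ordgeE. Qed.

(** In [(1 + q d)^2] with [ord q = i] the cross term [2 q d] has valuation at least [e + i > 2 i].
    Only [q^2 d^2] matters at level [2 i], and every residue is a square. *)
Lemma square_step i w : 0 <= i < e -> w \in val_unit K -> w - 1 \in ordge (2 * i) ->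
  exists2 d, d \in val_unit K & w - d ^+ 2 \in ordge (2 * i + 1).
Proof.
move=> ie uw hw; have [q q0 oq] := exists_ord i.
have q20 : q ^+ 2 != 0 by rewrite expf_neq0.
have oq2 : ord (q ^+ 2) = 2 * i by rewrite ord_exp// oq; ord_lia.
pose c := (w - 1) / q ^+ 2.
have c0 : c \in ordge 0 by rewrite /c; have := ordge_div q20 hw; rewrite oq2 subrr.
have [d d0 dc] := residue_square2 Kfin two_ordge1 c0.
have hd : w - (1 + q * d) ^+ 2 \in ordge (2 * i + 1).
  have -> : w - (1 + q * d) ^+ 2 = - (q ^+ 2 * (d ^+ 2 - c)) - 2 * (q * d).
    by rewrite mulrBr /c [_ * (_ / _)]mulrC divfK//; ring.
  rewrite rpredB ?rpredN//; first by apply: (ordgeMW _ (ordge_ord _) dc); ord_lia.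
  by apply: (ordgeMW _ (ordge_ord _) (ordgeM (ordge_ord _) d0)); ord_lia.
exists (1 + q * d) => //; apply: ordge0_unit.
  by rewrite rpredD// ?ordge0_1// ordge0Mr//; apply: ordgeW (ordge_ord q); ord_lia.
apply/negP => h1.
have h2 : w - (1 + q * d) ^+ 2 \in ordge 1 by apply: ordgeW hd; ord_lia.
have /unitP[n0 on] := unit_congr uw h2.
have : (1 + q * d) ^+ 2 \in ordge 1 by rewrite expr2 ordge0Ml// ordge1W.
by rewrite ordgeE// on.
Qed.

Lemma norm_step_even b i : 0 <= i < e -> norm_step b (2 * i).
Proof.
move=> ie w uw hw; have [d _ hd] := square_step ie uw hw.
by exists (d ^+ 2) => //; exact: is_norm_square.
Qed.

(* The norm group contains every unit up to one bit, located at level [j]. *)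
Lemma norm_index2_units b j (g a : K) : 1 <= j ->
  (forall i, 0 <= i < j -> norm_step b i) ->
  (forall w, w \in val_unit K -> w - 1 \in ordge (j + 1) -> is_norm b w) ->
  g != 0 -> ord g = j -> a \in val_unit K ->
  (forall d, d \in ordge 0 -> is_norm b (1 + g * (a * d ^+ 2 + d))) ->
  forall x y, x \in val_unit K -> y \in val_unit K ->
    [\/ is_norm b x, is_norm b y | is_norm b (x * y)].
Proof.
move=> j1 low top g0 og ua mid x y ux uy.
have x0 z : z \in val_unit K -> z - 1 \in ordge 0.
  by move=> uz; rewrite rpredB ?ordge0_1 ?unit_ordge0.
have low' i : 0 <= i < 0 + `|j|%N%:Z -> norm_step b i by move=> hi; apply: low; ord_lia.
have [h [v [uh Nh -> uv hv]]] := norm_approx (lexx 0) low' ux (x0 _ ux).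
have [k [w [uk Nk -> uw hw]]] := norm_approx (lexx 0) low' uy (x0 _ uy).
have ej : 0 + `|j|%N%:Z = j by ord_lia.
rewrite ej in hv hw.
pose c := (v - 1) / g; pose c' := (w - 1) / g.
have c0 : c \in ordge 0 by have := ordge_div g0 hv; rewrite og subrr.
have c'0 : c' \in ordge 0 by have := ordge_div g0 hw; rewrite og subrr.
have vE : v = 1 + g * c by rewrite /c [g * _]mulrC divfK//; ring.
have wE : w = 1 + g * c' by rewrite /c' [g * _]mulrC divfK//; ring.
have u1 : (1 : K) \in val_unit K by apply/unitP; rewrite oner_neq0 Defs.ord1.
have key z s r : z \in val_unit K -> r \in ordge (j + 1) -> z = 1 + g * s + r ->
    residue_AS a 1 s -> is_norm b z.
  move=> uz hr zE [d d0 hd]; pose m := 1 + g * (a * d ^+ 2 + d).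
  have zm : z - m \in ordge (j + 1).
    have -> : z - m = r - g * (a * d ^+ 2 + 1 * d - s) by rewrite zE /m; ring.
    by rewrite rpredB//; apply: (ordgeMW _ (ordge_ord _) hd); ord_lia.
  have um : m \in val_unit K by apply: (unit_congr uz); apply: ordgeW zm; ord_lia.
  rewrite -(divfK (unit_neq0 um) z); apply: is_normM; last exact: mid.
  by apply: top; [rewrite unitM// unitV|exact: unit_div_near1].
have [Ac|Ac|Ac] := residue_AS_index2 Kfin two_ordge1 ua u1 c0 c'0.
- constructor 1; apply: is_normM => //.
  by apply: (key _ c 0 uv (rpred0 _)) => //; rewrite addr0.
- constructor 2; apply: is_normM => //.
  by apply: (key _ c' 0 uw (rpred0 _)) => //; rewrite addr0.
- constructor 3; rewrite mulrACA; apply: is_normM; first exact: is_normM.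
  (* The product of the two cofactors is [1 + g (c + c')] up to [g^2 c c'], of valuation at least
     [2 j], which lies beyond level [j] because [1 <= j]. *)
  apply: (key _ (c + c') (g * c * (g * c'))) => //; first exact: unitM.
    apply: (ordgeMW _ (ordgeM (ordge_ord g) c0) (ordgeM (ordge_ord g) c'0)); ord_lia.
  by rewrite {1}vE {1}wE; ring.
Qed.

(** Beyond level [2 e] all units are squares, so finitely many steps reach an exact norm. *)
Lemma norm_top b j : (forall i, j <= i < 1 + 2 * e -> norm_step b i) -> 0 <= j <= 1 + 2 * e ->
  forall w, w \in val_unit K -> w - 1 \in ordge j -> is_norm b w.
Proof.
move=> hstep j0 w uw hw.
have [|i hi|h [v [_ Nh -> _ hv]]] := @norm_approx b j `|(1 + 2 * e - j)%R|%N _ _ w uw hw.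
- ord_lia.
- by apply: hstep; ord_lia.
- apply: is_normM => //; apply: is_norm_near1; apply: ordgeW hv; ord_lia.
Qed.

(* Even levels are reached by squares, odd ones by [1 - b y^2]; the exceptional level
   is [2 e], reached by [(1 + 2 d)^2 = 1 + 4 (d^2 + d)]. *)
Lemma norm_index2_uniformizer b : b != 0 -> ord b = 1 ->
  forall x y, x != 0 -> y != 0 -> [\/ is_norm b x, is_norm b y | is_norm b (x * y)].
Proof.
move=> b0 ob; apply: norm_index2_of_odd.
  exists (- b); rewrite oppr_eq0 ordN; split; [exact: is_normN|by []|by exists 0; ord_lia].
have u1 : (1 : K) \in val_unit K by apply/unitP; rewrite oner_neq0 Defs.ord1.
apply: (@norm_index2_units b (2 * e) (2 ^+ 2) 1) => //.
- by ord_lia.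
- move=> j je; have [i [jE|jE]] := int_parity j.
    by rewrite jE; apply: norm_step_even; ord_lia.
  move=> w uw hw; have [q q0 oq] := exists_ord i.
  have bq0 : b * q ^+ 2 != 0 by rewrite mulf_neq0// expf_neq0.
  have obq : ord (b * q ^+ 2) = j by rewrite ordM ?expf_neq0// ord_exp// oq ob; ord_lia.
  pose c := (w - 1) / (b * q ^+ 2).
  have c0 : - c \in ordge 0 by rewrite rpredN; have := ordge_div bq0 hw; rewrite obq subrr.
  have [d d0 dc] := residue_square2 Kfin two_ordge1 c0.
  exists (1 - b * (q * d) ^+ 2); first by exists 1, (q * d); ring.
  have -> : w - (1 - b * (q * d) ^+ 2) = (b * q ^+ 2) * (d ^+ 2 - - c).
    by rewrite opprK mulrDr /c [_ * (_ / _)]mulrC divfK//; ring.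
  by apply: (ordgeMW _ (ordge_ord _) dc); ord_lia.
- by move=> w _ hw; apply: is_norm_near1; apply: ordgeW hw; ord_lia.
- by rewrite expf_neq0.
- by rewrite ord_exp//; ord_lia.
- move=> d d0; have -> : 1 + 2 ^+ 2 * (1 * d ^+ 2 + d) = (1 + 2 * d) ^+ 2 by ring.
  exact: is_norm_square.
Qed.

(* Either [b] is [1 + 4 r] up to squares, so that adjoining its square root gives an
   unramified extension, or its distance to the squares has odd valuation. *)
Lemma quadratic_defect b : b \in val_unit K ->
  exists2 s, s \in val_unit K & b * s ^+ 2 - 1 \in ordge (2 * e) \/
    exists2 m, 0 <= m /\ 2 * m + 1 < 2 * e &
      b * s ^+ 2 - 1 != 0 /\ ord (b * s ^+ 2 - 1) = 2 * m + 1.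
Proof.
move=> ub.
suff H (n : nat) : n%:Z <= 2 * e -> exists2 s, s \in val_unit K &
    b * s ^+ 2 - 1 \in ordge n%:Z \/ exists2 m, 0 <= m /\ 2 * m + 1 < 2 * e &
      b * s ^+ 2 - 1 != 0 /\ ord (b * s ^+ 2 - 1) = 2 * m + 1.
  have [|s us hs] := H `|(2 * e)%R|%N; first by ord_lia.
  exists s => //; case: hs => [h|h]; [left; apply: ordgeW h; ord_lia|by right].
elim: n => [_|n IH ne].
  exists 1; first by apply/unitP; rewrite oner_neq0 Defs.ord1.
  by left; rewrite rpredB ?ordge0_1// expr1n mulr1 unit_ordge0.
have [|s us [hs|hs]] := IH; [by ord_lia| |by exists s => //; right].
(* At an even level a square removes the leading term; at an odd one [b s^2 - 1] is either deeper
   already or of valuation exactly [n]. *)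
have [i [nE|nE]] := int_parity n%:Z; last first.
  exists s => //; have [h|h] := boolP (b * s ^+ 2 - 1 \in ordge n.+1%:Z); first by left.
  right; exists i; first by ord_lia.
  have x0 : b * s ^+ 2 - 1 != 0 by apply: contraNneq h => ->; rewrite rpred0.
  by split=> //; move: hs h; rewrite !ordgeE//; ord_lia.
rewrite nE in hs; have [||d ud hd] := square_step _ _ hs.
- by ord_lia.
- by rewrite expr2 !unitM.
exists (s / d); first by rewrite unitM// unitV.
left; have -> : b * (s / d) ^+ 2 - 1 = (b * s ^+ 2) / d ^+ 2 - 1 by rewrite expr_div_n mulrA.
apply: unit_div_near1; first by rewrite expr2 unitM.
by apply: ordgeW hd; ord_lia.
Qed.

(** With [b = 1 + 4 r] the element [(1 + sqrt b) / 2] is integral and has norm form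
    [s^2 + s y - r y^2]. At [s = 1], [y = w - 1] this form differs from [w] by [r (w - 1)^2], a gain
    at every level [j >= 1]; level 0 is reached by squares. *)
Lemma norm_index2_unramified b : b - 1 \in ordge (2 * e) ->
  forall w, w \in val_unit K -> is_norm b w.
Proof.
move=> hb w uw.
have four0 : (2 ^+ 2 : K) != 0 by rewrite expf_neq0.
pose r := (b - 1) / 2 ^+ 2.
have r0 : r \in ordge 0.
  by have := ordge_div four0 hb; rewrite ord_exp// (_ : 2 * e - _ = 0)//; ord_lia.
have bE : b = 1 + 2 ^+ 2 * r by rewrite /r [_ * (_ / _)]mulrC divfK//; ring.
have N s y : is_norm b (s ^+ 2 + s * y - r * y ^+ 2).
  by exists (s + y / 2), (y / 2); rewrite bE; field.
apply: (@norm_top b 0) => //; last by rewrite rpredB ?ordge0_1// unit_ordge0.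
- move=> j je {uw}w uw hw1; have [jE|jE] := eqVneq j 0.
    by rewrite jE in hw1 *; apply: (@norm_step_even b 0); rewrite ?mulr0//; ord_lia.
  have j1 : 1 <= j by move: je jE; clear; lia.
  exists (1 ^+ 2 + 1 * (w - 1) - r * (w - 1) ^+ 2) => //.
  have -> : w - (1 ^+ 2 + 1 * (w - 1) - r * (w - 1) ^+ 2) = r * ((w - 1) * (w - 1)) by ring.
  by apply: (ordgeMW _ r0 (ordgeM hw1 hw1)); ord_lia.
- by ord_lia.
Qed.

(* With [t = b - 1] of valuation [k], the norms [1 + 2 y - t y^2] are dominated by their
   last term below level [2 e - k] and by the middle one above it. *)
Lemma norm_index2_ramified b m : 0 <= m -> 2 * m + 1 < 2 * e ->
  b - 1 != 0 -> ord (b - 1) = 2 * m + 1 ->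
  forall x y, x != 0 -> y != 0 -> [\/ is_norm b x, is_norm b y | is_norm b (x * y)].
Proof.
move=> m0 me; set t := b - 1 => t0 ot.
have bE : b = 1 + t by rewrite /t; ring.
have N s y : is_norm b (s ^+ 2 + 2 * s * y - t * y ^+ 2).
  by exists (s + y), y; rewrite bE; ring.
apply: norm_index2_of_odd.
  exists (- t); rewrite oppr_eq0 ordN; split=> //; last by exists m.
  by have := N 0 1; rewrite (_ : _ - _ = - t)//; ring.
have oM q : q != 0 -> ord (t * q ^+ 2) = 2 * m + 1 + 2 * ord q.
  by move=> q0; rewrite ordM ?expf_neq0// ord_exp//; ord_lia.
have tq0 q : q != 0 -> t * q ^+ 2 != 0 by move=> q0; rewrite mulf_neq0// expf_neq0.
(* For [y] of this valuation the terms [2 y] and [t y^2] have the same valuation [2 e - (2 m + 1)].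
   This is the exceptional level, where both terms contribute to the residue. *)
have [q q0 oq] := exists_ord (e - 2 * m - 1).
have g0 : 2 * q != 0 by rewrite mulf_neq0.
have og : ord (2 * q) = 2 * e - 2 * m - 1 by rewrite ordM// oq; ord_lia.
apply: (@norm_index2_units b (2 * e - 2 * m - 1) (2 * q) (- (t * q ^+ 2) / (2 * q))) => //.
- by ord_lia.
- move=> j je; have [i [jE|jE]] := int_parity j.
    by rewrite jE; apply: norm_step_even; ord_lia.
  move=> w uw hw; have [s s0 os] := exists_ord (i - m).
  pose c := (w - 1) / (t * s ^+ 2).
  have c0 : - c \in ordge 0.
    by rewrite rpredN; have := ordge_div (tq0 _ s0) hw; rewrite oM// os (_ : j - _ = 0)//; ord_lia.
  have [d d0 dc] := residue_square2 Kfin two_ordge1 c0.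
  exists (1 ^+ 2 + 2 * 1 * (s * d) - t * (s * d) ^+ 2) => //.
  have -> : w - (1 ^+ 2 + 2 * 1 * (s * d) - t * (s * d) ^+ 2) =
      (t * s ^+ 2) * (d ^+ 2 - - c) - 2 * (s * d).
    by rewrite opprK mulrDr /c [_ * (_ / _)]mulrC divfK ?tq0//; ring.
  rewrite rpredB//.
    by apply: (ordgeMW _ (ordge_ord _) dc); rewrite oM//; ord_lia.
  by apply: (ordgeMW _ (ordge_ord _) (ordgeM (ordge_ord _) d0)); ord_lia.
- move=> w uw hw; apply: (@norm_top b (2 * e - 2 * m)) => //; last by apply: ordgeW hw; ord_lia.
    move=> j je {uw hw}w uw hw; pose y := (w - 1) / 2.
    have hy : y \in ordge (j - e) by exact: ordge_div.
    have wE : w = 1 + 2 * y by rewrite /y [2 * _]mulrC divfK//; ring.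
    exists (1 ^+ 2 + 2 * 1 * y - t * y ^+ 2) => //.
    have -> : w - (1 ^+ 2 + 2 * 1 * y - t * y ^+ 2) = t * (y * y) by rewrite wE; ring.
    by apply: (ordgeMW _ (ordge_ord _) (ordgeM hy hy)); ord_lia.
  by ord_lia.
- apply/unitP; split; first by rewrite mulf_neq0 ?oppr_eq0 ?tq0// invr_neq0.
  by rewrite ordM ?oppr_eq0 ?tq0 ?invr_neq0// ordN oM// ordV// og oq; ord_lia.
- move=> d d0; have := N 1 (q * d); congr is_norm.
  have g0' := g0; field; rewrite two0 q0 //.
Qed.

End NormGroup.

Section NormIndex.
Variable K : valuedFieldType.
Hypothesis two0 : (2 : K) != 0.
Hypothesis Kcomplete : forall A : set_system K, ProperFilter A -> cauchy A -> cvg A.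
Hypothesis Kfin : finite_residue K.
Hypothesis Kunif : exists2 p : K, p != 0 & ord p = 1.

(** Changing [b] by a square does not affect its norms, so [b] may be taken of valuation 0 or 1. In
    residue characteristic 2 a unit [b] is then sorted by its distance to the squares. *)
Theorem norm_index2 (b x y : K) : b != 0 -> x != 0 -> y != 0 ->
  [\/ is_norm b x, is_norm b y | is_norm b (x * y)].
Proof.
have [p p0 op] := Kunif; move=> b0.
suff H (c : K) : c != 0 -> (ord c = 0 \/ ord c = 1) -> forall x y : K, x != 0 -> y != 0 ->
    [\/ is_norm c x, is_norm c y | is_norm c (x * y)].
  have [m om] := int_parity (ord b); have [q q0 oq] := exists_ord p0 op (- m).
  have bq0 : b * q ^+ 2 != 0 by rewrite mulf_neq0// expf_neq0.
  have obq : ord (b * q ^+ 2) = 0 \/ ord (b * q ^+ 2) = 1.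
    by rewrite ordM ?expf_neq0// ord_exp// oq; case: om => ->; [left|right]; ord_lia.
  move=> x0 y0; have D z := @is_norm_mul_square _ b q z q0.
  have [/D h|/D h|/D h] := H _ bq0 obq x y x0 y0.
  - by constructor 1.
  - by constructor 2.
  - by constructor 3.
move=> {b b0 x y}c0 oc; have e0 := ord2_ge0 two0.
have [e1|e1] := leP 1 (ord (2 : K)).
  case: oc => oc; last first.
    exact: (norm_index2_uniformizer two0 Kcomplete Kfin p0 op e1 c0 oc).
  have uc : c \in val_unit K by apply/unitP.
  have [s us hs] := quadratic_defect two0 Kfin p0 op e1 uc.
  have D z := @is_norm_mul_square _ c s z (unit_neq0 us).
  case: hs => [hs|[m [m0 me] [n0 on]]].
    apply: (norm_index2_of_units p0 op) => x ux; apply: D.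
    exact: (norm_index2_unramified two0 Kcomplete Kfin p0 op e1 hs ux).
  move=> x y x0 y0.
  have [/D h|/D h|/D h] :=
    norm_index2_ramified two0 Kcomplete Kfin p0 op e1 m0 me n0 on x0 y0.
  - by constructor 1.
  - by constructor 2.
  - by constructor 3.
have e2 : ord (2 : K) = 0 by ord_lia.
(* When 2 is a unit, [1 + P] consists of squares, so whether a unit is a norm depends only on its
   residue. *)
have near (b z g : K) : z \in val_unit K -> is_norm b g -> g - z \in ordge 1 -> is_norm b z.
  move=> uz Ng gz; have zg : z - g \in ordge 1 by rewrite -opprB rpredN.
  have ug := unit_congr uz zg.
  rewrite -(divfK (unit_neq0 ug) z); apply: is_normM => //; apply: is_norm_near1 => //.
  by rewrite e2 mulr0 addr0; exact: unit_div_near1.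
case: oc => oc.
  have uc : c \in val_unit K by apply/unitP.
  apply: (norm_index2_of_units p0 op) => x ux.
  have [s [y [_ _ h]]] := residue_norm_surj Kfin uc (unit_ordge0 ux).
  by apply: near h => //; exists s, y.
apply: (norm_index2_of_odd p0 op).
  exists (- c); rewrite oppr_eq0 ordN; split; [exact: is_normN|by []|by exists 0; ord_lia].
have sq z : z \in val_unit K -> residue_square z -> is_norm c z.
  by move=> uz [d _ h]; apply: near h => //; exact: is_norm_square.
move=> x y ux uy.
have [h|h|h] := residue_square_index2 Kfin ux uy.
- by constructor 1; exact: sq.
- by constructor 2; exact: sq.
- by constructor 3; apply: sq => //; exact: unitM.
Qed.

End NormIndex.

(** * The Hilbert symbol and the Hasse invariant *)

Section HilbertSymbol.
Variable K : valuedFieldType.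
Implicit Types (a b x y : K).
Hypothesis two0 : (2 : K) != 0.

Lemma is_norm_of_square c x : c != 0 -> is_norm (c ^+ 2) x.
Proof. by move=> c0; exists ((x + 1) / 2), ((x - 1) / (2 * c)); field; rewrite c0. Qed.

(** A solution with [x != 0] is divided by [x]. One with [x = 0] makes [b] a square; the norm form
    is then hyperbolic and represents everything. *)
Lemma hilbertE a b : a != 0 -> b != 0 ->
  hilbert a b = if `[< is_norm b a >] then 1 else -1.
Proof.
move=> a0 b0; rewrite /hilbert; congr (if _ then _ else _); apply/asboolP/asboolP.
  move=> [x [y [z [n0 zE]]]]; have [x0|x0] := eqVneq x 0; last first.
    by exists (z / x), (y / x); rewrite expr_div_n zE; field.
  have [y0|y0] := eqVneq y 0.
    move: zE; rewrite x0 y0 !expr0n /= !mulr0 addr0 => /eqP; rewrite expf_eq0 /= => /eqP z0.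
    by move: n0; rewrite x0 y0 z0 eqxx.
  have bE : b = (z / y) ^+ 2.
    by rewrite expr_div_n zE x0 expr0n /= mulr0 add0r mulfK// expf_neq0.
  rewrite bE; apply: is_norm_of_square.
  by apply: contraNneq b0 => h; rewrite bE h expr0n.
move=> [z [y aE]]; exists 1, y, z; split; last by rewrite aE; ring.
by rewrite !xpair_eqE oner_eq0.
Qed.

Lemma hilbertC a b : hilbert a b = hilbert b a.
Proof.
rewrite /hilbert; congr (if _ then _ else _); apply/asboolP/asboolP;
  move=> [x [y [z [n0 zE]]]]; exists y, x, z; (split; last by rewrite zE addrC);
  by apply: contraNneq n0 => -[-> -> ->].
Qed.

Lemma hilbert_sqr a b : hilbert a b * hilbert a b = 1.
Proof. by rewrite /hilbert; case: ifP. Qed.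

Hypothesis Kcomplete : forall A : set_system K, ProperFilter A -> cauchy A -> cvg A.
Hypothesis Kfin : finite_residue K.
Hypothesis Kunif : exists2 p : K, p != 0 & ord p = 1.

Lemma hilbertMl a a' b : a != 0 -> a' != 0 -> b != 0 ->
  hilbert (a * a') b = hilbert a b * hilbert a' b.
Proof.
move=> a0 a'0 b0; rewrite !hilbertE ?mulf_neq0//.
have [h1|h1] := pselect (is_norm b a).
  rewrite (asboolT h1) mul1r; congr (if _ then _ else _); apply/asboolP/asboolP.
    exact: is_norm_cancel.
  exact: is_normM.
rewrite (asboolF h1); have [h2|h2] := pselect (is_norm b a').
  rewrite (asboolT h2) mulr1 asboolF// mulrC => h; apply: h1.
  exact: is_norm_cancel h2 h.
rewrite (asboolF h2) mulrNN mulr1 asboolT//.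
by have [] := norm_index2 two0 Kcomplete Kfin Kunif b0 a0 a'0.
Qed.

Lemma hilbertMr a b b' : a != 0 -> b != 0 -> b' != 0 ->
  hilbert a (b * b') = hilbert a b * hilbert a b'.
Proof. by move=> a0 b0 b'0; rewrite hilbertC hilbertMl// ![hilbert _ a]hilbertC. Qed.

End HilbertSymbol.

Lemma prod_pairs_const (n : nat) (c : int) :
  \prod_(i < n) \prod_(j < n | (i < j)%N) c = c ^+ 'C(n, 2).
Proof.
rewrite (exchange_big_dep predT)//= -bin2_sum big_mkord -prodrXr; apply: eq_bigr => j _.
by rewrite -(big_ord_widen _ (fun=> c)) ?prodr_const ?card_ord// ltnW.
Qed.

(* Each index lies in [n - 1] pairs, an even number. *)
Lemma prod_pairs_even (n : nat) (g : 'I_n -> int) : odd n ->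
  (forall i, g i * g i = 1) ->
  \prod_(i < n) \prod_(j < n | (i < j)%N) (g i * g j) = 1.
Proof.
move=> on g2; under eq_bigr do rewrite big_split /=.
rewrite big_split /= [X in _ * X](exchange_big_dep predT)//= -big_split /=.
rewrite big1// => i _.
have -> : \prod_(j < n | (i < j)%N) g i * \prod_(j < n | (j < i)%N) g i =
    \prod_(j < n | j != i) g i.
  rewrite [RHS](bigID (fun j : 'I_n => (i < j)%N)) /=; congr (_ * _); apply: eq_bigl => j;
  by rewrite -(inj_eq val_inj) /=; case: ltngtP.
rewrite prodr_const (_ : #|_| = n.-1); last first.
  by rewrite -[in RHS](card_ord n) -(cardC1 i).
case: n on g g2 i => //= n /negbTE en g g2 i.
by rewrite -[X in _ ^+ X]odd_double_half en add0n -mul2n exprM expr2 g2 expr1n.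
Qed.

Section HasseScaling.
Variables (K : valuedFieldType) (n : nat).
Hypothesis two0 : (2 : K) != 0.
Hypothesis Kcomplete : forall A : set_system K, ProperFilter A -> cauchy A -> cvg A.
Hypothesis Kfin : finite_residue K.
Hypothesis Kunif : exists2 p : K, p != 0 & ord p = 1.

Lemma hasse_scale (a : 'I_n -> K) (u : K) : odd n -> u != 0 -> (forall i, a i != 0) ->
  \prod_(i < n) \prod_(j < n | (i < j)%N) hilbert (u * a i) (u * a j) =
  hilbert u u ^+ 'C(n, 2) * \prod_(i < n) \prod_(j < n | (i < j)%N) hilbert (a i) (a j).
Proof.
move=> on u0 a0; rewrite -prod_pairs_const.
(* The product over pairs of [(u, a_i) (u, a_j)] is 1; it is inserted on the right so that the two
   sides agree factor by factor. *)
rewrite -[RHS]mul1r -[X in _ = X * _](@prod_pairs_even n (fun i => hilbert u (a i)) on);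
  last first.
  by move=> i; exact: hilbert_sqr.
rewrite -[X in _ = _ * X]big_split /= -[RHS]big_split /=; apply: eq_bigr => i _.
rewrite -[X in _ = _ * X]big_split /= -[RHS]big_split /=; apply: eq_bigr => j _.
rewrite !(hilbertMl, hilbertMr)// ?mulf_neq0//.
by rewrite [hilbert (a i) u]hilbertC; ring.
Qed.

End HasseScaling.

(** * Completions of number fields *)

Section Completion.
Variables (F : fieldExtType rat) (p : prime_idealr (ring_of_integers F)).
Variables (K : valuedFieldType) (iota : {rmorphism F -> K}).
Hypothesis p_neq0 : exists2 a : ring_of_integers F, a != 0 & a \in p.
Hypothesis K_completion : is_completion p iota.

Lemma intr_neq0 (c : int) : c != 0 -> (c%:~R : K) != 0.
Proof.
move=> c0; have -> : (c%:~R : K) = iota (in_alg F (c%:~R : rat)) by rewrite !rmorph_int.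
by rewrite !fmorph_eq0 intr_eq0.
Qed.

Lemma completion_two_neq0 : (2 : K) != 0.
Proof. exact: (@intr_neq0 2). Qed.

Lemma iota_approx (x : K) k : exists f, x - iota f \in ordge k.
Proof.
have [_ [iotad _]] := K_completion.
have Oo : open [set y | x - y \in ordge k].
  rewrite openE => y /= xy; apply/nbhs_ordgeP; exists k => z yz /=.
  by rewrite -(subrK y x) -addrA rpredD.
have [|y [/= xy [f _ fy]]] := iotad _ _ Oo; first by exists x; rewrite /= subrr rpred0.
by exists f; rewrite fy.
Qed.

Lemma intr_ordge0 (c : int) : (c%:~R : K) \in ordge 0.
Proof. by rewrite -ordge0E rpred_int. Qed.

Lemma horner_int_ordge0 (P : {poly int}) (x : K) : x \in ordge 0 ->
  (map_poly intr P).[x] \in ordge 0.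
Proof.
move=> x0; rewrite -ordge0E; apply: rpred_horner => //.
by apply/polyOverP => i; rewrite coef_map /= rpred_int.
Qed.

(** After removing powers of [X] the constant coefficient is nonzero, and at the root it equals
    minus a multiple of [x], so it lies in the maximal ideal. *)
Lemma root_ordge1_int (P : {poly int}) (x : K) : P != 0 -> x != 0 -> x \in ordge 1 ->
  root (map_poly intr P) x -> exists2 c : int, c != 0 & (c%:~R : K) \in ordge 1.
Proof.
elim/poly_ind: P => [|P c IH]; first by rewrite eqxx.
move=> Pc0 x0 x1; rewrite rmorphD rmorphM /= map_polyX map_polyC /= /root.
rewrite hornerD hornerMX hornerC => /eqP E.
have [c0|c0] := eqVneq c 0; last first.
  exists c => //; move/eqP: E; rewrite addrC addr_eq0 => /eqP->.
  by rewrite rpredN ordge0Ml//; exact/horner_int_ordge0/ordge1W.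
apply: IH => //; first by apply: contraNneq Pc0 => ->; rewrite mul0r c0 addr0.
by move/eqP: E; rewrite c0 mulr0z addr0 mulf_eq0 (negbTE x0) orbF.
Qed.

(** A nonzero element of [p] is a root of a monic integer polynomial, which yields a nonzero integer
    in the maximal ideal. One of its prime factors lies there too. *)
Lemma residue_char : exists2 l, prime l & (l%:R : K) \in ordge 1.
Proof.
have [a a0 ap] := p_neq0; have [hord _] := K_completion.
have ia0 : iota (val a) != 0 by rewrite fmorph_eq0.
have ia1 : iota (val a) \in ordge 1.
  rewrite ordgeE//; apply/(hord a 1%N a0); exists 1%N, (fun=> a), (fun=> 1).
  by rewrite big_ord1 mulr1.
have [P Pm Pa] := asboolP _ (valP a).
have [c c0 c1] : exists2 c : int, c != 0 & (c%:~R : K) \in ordge 1.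
  apply: (root_ordge1_int (monic_neq0 Pm) ia0 ia1).
  have -> : map_poly (intr : int -> K) P = map_poly iota (map_poly intr P).
    by rewrite -map_poly_comp; apply: eq_map_poly => i /=; rewrite rmorph_int.
  by rewrite fmorph_root.
have : (`|c|%N%:R : K) \in ordge 1.
  by move: c1; rewrite {1}(intEsign c) rmorphM /= rmorph_sign; case: (c < 0);
    rewrite ?expr1 ?expr0 ?mulN1r ?mul1r ?rpredN.
have : (0 < `|c|)%N by rewrite absz_gt0.
move: `|c|%N => m {P Pm Pa c c0 c1}.
elim/ltn_ind: m => m IH m0 m1.
have [m_le1|m_gt1] := leqP m 1.
  have mE : m = 1%N by lia.
  by move: m1; rewrite mE ordgeE ?oner_neq0// Defs.ord1.
have q_pr := pdiv_prime m_gt1; have q_dvd := pdiv_dvd m.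
have mE : m = (pdiv m * (m %/ pdiv m))%N by rewrite mulnC divnK.
move: m1; rewrite [X in X%:R]mE natrM.
move=> /ordge1_mul_eq0[|h|h]; first exact: (intr_ordge0 (pdiv m)).
  by exists (pdiv m).
apply: IH h; first by rewrite ltn_Pdiv// prime_gt1.
by rewrite divn_gt0 ?pdiv_gt0// dvdn_leq.
Qed.

Lemma numfield_countable : exists D : F -> nat, injective D.
Proof.
exists (fun x => pickle [ffun i => coord (vbasis {:F}) i x]).
move=> x y /(pcan_inj pickleK)/ffunP xy.
rewrite (coord_vbasis (memvf x)) (coord_vbasis (memvf y)); apply: eq_bigr => i _.
by have := xy i; rewrite !ffunE => ->.
Qed.

(** * Finiteness of the residue field *)

Section FixChar.
Variable l : nat.
Hypothesis l_prime : prime l.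
Hypothesis l1 : (l%:R : K) \in ordge 1.

Lemma dvdz_ordge1 (c : int) (x : K) : (l %| c)%Z -> x \in ordge 0 -> c%:~R * x \in ordge 1.
Proof.
move=> /dvdzP[d ->] x0; rewrite rmorphM /= -mulrA ordge0Ml ?intr_ordge0//.
by rewrite ordge0Mr.
Qed.

(** Independence of the residues over the field with [l] elements, phrased with integer coefficients
    so that relations can be carried to [F]. *)
Definition res_free (r : nat) (x : 'I_r -> K) : Prop :=
  (forall i, x i \in ordge 0) /\
  forall c : 'I_r -> int, \sum_i (c i)%:~R * x i \in ordge 1 -> forall i, (l %| c i)%Z.

(* Descent: the coefficients of a relation are divisible by every power of [l]. *)
Lemma res_free_rat (r : nat) (f : 'I_r -> F) : res_free (fun i => iota (f i)) ->
  forall c : 'I_r -> int, \sum_i (c i)%:~R * f i = 0 -> forall i, c i = 0.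
Proof.
move=> [f0 ff] c cf.
have dv (N : nat) : forall c : 'I_r -> int, \sum_i (c i)%:~R * f i = 0 ->
    forall i, (l%:Z ^+ N %| c i)%Z.
  elim: N => [|N IH] {cf}c cf i; first by rewrite expr0 dvd1z.
  have ld j : (l %| c j)%Z.
    apply: ff; suff -> : \sum_i (c i)%:~R * iota (f i) = 0 by rewrite rpred0.
    rewrite -[RHS](rmorph0 iota) -cf rmorph_sum; apply: eq_bigr => k _.
    by rewrite rmorphM rmorph_int.
  have l0 : (l%:~R : F) != 0.
    by rewrite -(fmorph_eq0 iota) rmorph_int intr_neq0// -lt0n prime_gt0.
  rewrite -(divzK (ld i)) exprSr dvdz_mul//.
  apply: (IH (fun k => (c k %/ l)%Z)).
  apply: (mulIf l0); rewrite mul0r -[RHS]cf mulr_suml; apply: eq_bigr => k _.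
  by rewrite mulrAC -intrM divzK.
move=> i; apply/eqP/negPn/negP => ci0.
have := dvdn_leq _ (dv `|c i|%N c cf i).
rewrite abszX absz_gt0 => /(_ ci0); rewrite leqNgt => /negP; apply.
exact/ltn_expl/prime_gt1.
Qed.

Lemma int_free_dim (r : nat) (f : 'I_r -> F) :
  (forall c : 'I_r -> int, \sum_i (c i)%:~R * f i = 0 -> forall i, c i = 0) ->
  (r <= \dim {:F})%N.
Proof.
move=> ff; pose X := [tuple f i | i < r].
suff /eqnP : free X by rewrite size_tuple => <-; apply: dimvS; exact: subvf.
apply/freeP => k kX i.
pose c i := numq (k i) * \prod_(j | j != i) denq (k j).
have cE j : ((c j)%:~R : rat) = k j * (\prod_j denq (k j))%:~R.
  rewrite /c [in RHS](bigD1 j)//= !intrM mulrA; congr (_ * _).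
  by rewrite -{2}[k j]divq_num_den divfK// intr_eq0 denq_eq0.
have /ff/(_ i) ci : \sum_i (c i)%:~R * f i = 0.
  transitivity (((\prod_j denq (k j))%:~R : rat) *: (\sum_(i < r) k i *: X`_i)).
    rewrite scaler_sumr; apply: eq_bigr => j _.
    rewrite -tnth_nth tnth_mktuple scalerA mulrC [_ * k j]mulrC -cE.
    by rewrite scaler_int mulrzr.
  by rewrite kX scaler0.
move/eqP: ci; rewrite /c mulf_eq0 numq_eq0 => /orP[/eqP//|].
by rewrite prodf_seq_eq0 => /hasP[j _ /andP[_]]; rewrite denq_eq0.
Qed.

Lemma res_free_dim r (x : 'I_r -> K) : res_free x -> (r <= \dim {:F})%N.
Proof.
move=> [x0 xf]; have /choice[f xfE] i := iota_approx (x i) 1.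
apply: (@int_free_dim _ f); apply: res_free_rat; split=> [i|c hc].
  by rewrite -(subKr (x i) (iota (f i))) rpredB// ordge1W.
apply: xf; have -> : \sum_i (c i)%:~R * x i =
    \sum_i (c i)%:~R * iota (f i) + \sum_i (c i)%:~R * (x i - iota (f i)).
  by rewrite -big_split; apply: eq_bigr => i _ /=; ring.
by rewrite rpredD// rpred_sum// => i _; rewrite ordge0Ml ?intr_ordge0.
Qed.

Definition res_cover (q : nat) (r : 'I_q -> K) : Prop :=
  (forall i, r i \in ordge 0) /\ forall x, x \in ordge 0 -> exists i, x - r i \in ordge 1.

(** A family of independent residues of maximal size exists by the degree bound. It spans the
    residue field over the field with [l] elements, so its combinations with coefficients in
    [[0, l)] meet every class. *)
Lemma exists_res_cover : exists q (r : 'I_q -> K), res_cover r.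
Proof.
pose P r := `[< exists x : 'I_r -> K, res_free x >].
have P0 : exists r, P r.
  exists 0%N; apply/asboolP; exists (fun=> 0); split=> [|c _ []//].
  by move=> i; exact: rpred0.
have Pdim r : P r -> (r <= \dim {:F})%N by move=> /asboolP[x]; exact: res_free_dim.
case: (ex_maxnP P0 Pdim) => r /asboolP[X [X0 XF]] rmax.
pose R (g : {ffun 'I_r -> 'I_l}) : K := \sum_i (g i)%:R * X i.
exists #|{: {ffun 'I_r -> 'I_l}}|, (fun i => R (enum_val i)); split.
  by move=> i; rewrite rpred_sum// => j _; rewrite ordge0M//; exact: (intr_ordge0 (enum_val i j)).
move=> x x0; pose Y i := oapp X x (unlift ord0 i).
have [c [cY [i0 ci0]]] : exists c : 'I_r.+1 -> int,
    \sum_i (c i)%:~R * Y i \in ordge 1 /\ exists i, ~~ (l %| c i)%Z.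
  apply: contrapT => nc; suff : P r.+1 by move=> /rmax; rewrite ltnn.
  apply/asboolP; exists Y; split=> [i|c cY i].
    by rewrite /Y; case: unliftP => [j _|_] /=.
  by apply/negPn/negP => h; apply: nc; exists c; split=> //; exists i.
have YE : \sum_i (c i)%:~R * Y i =
    (c ord0)%:~R * x + \sum_i (c (lift ord0 i))%:~R * X i.
  by rewrite big_ord_recl /Y unlift_none; congr (_ + _); apply: eq_bigr => i _; rewrite liftK.
rewrite YE in cY.
(* Otherwise the relation would reduce to one among the [X i], whose independence makes all the
   coefficients divisible by [l]. *)
have c0 : ~~ (l %| c ord0)%Z.
  apply: contra ci0 => lc; have := rpredB cY (dvdz_ordge1 lc x0).
  rewrite addrC addKr => /XF h.
  by have [j ->|->] := unliftP ord0 i0.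
have cop : coprimez (c ord0) l by rewrite coprimez_sym coprimezE prime_coprime.
(* [u] inverts the coefficient of [x] modulo [l]; multiplying the relation by [u] expresses the
   residue of [x] through those of the [X i]. *)
have [[u v] /= uv] := coprimezP _ _ cop.
have l_gt0 : 0 < (l%:Z) by rewrite ltz_nat prime_gt0.
pose e i := (- (u * c (lift ord0 i)) %% l)%Z.
have e_lt i : (`|e i| < l)%N.
  by have := ltz_pmod (- (u * c (lift ord0 i))) l_gt0;
     have := modz_ge0 (- (u * c (lift ord0 i))) (lt0r_neq0 l_gt0); rewrite /e; lia.
have eE i : (`|e i|%N%:R : K) = (e i)%:~R.
  rewrite -[LHS]/((`|e i|%N)%:Z%:~R) gez0_abs//.
  exact: modz_ge0 (lt0r_neq0 l_gt0).
exists (enum_rank [ffun i => Ordinal (e_lt i)]); rewrite enum_rankK /R.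
under eq_bigr do rewrite ffunE /= eE.
have lE : (l%:Z%:~R : K) = l%:R by [].
have -> : x - \sum_i (e i)%:~R * X i =
    u%:~R * ((c ord0)%:~R * x + \sum_i (c (lift ord0 i))%:~R * X i) +
    v%:~R * (l%:R * x) +
    \sum_i (l%:R * ((- (u * c (lift ord0 i)) %/ l)%Z%:~R * X i)).
  have {1}-> : x = (u * c ord0 + v * l)%:~R * x by rewrite uv mul1r.
  have -> : \sum_i (e i)%:~R * X i = - (u%:~R * \sum_i (c (lift ord0 i))%:~R * X i) -
      \sum_i (l%:R * ((- (u * c (lift ord0 i)) %/ l)%Z%:~R * X i)).
    rewrite mulr_sumr -sumrN -sumrB; apply: eq_bigr => i _.
    have -> : e i = - (u * c (lift ord0 i)) - (- (u * c (lift ord0 i)) %/ l)%Z * l.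
      by rewrite {1}[X in X - _](divz_eq _ l) addrC addKr.
    by rewrite !(intrD, mulrNz, intrM) lE; ring.
  by rewrite intrD !intrM lE; ring.
rewrite rpredD ?rpred_sum//; last by move=> i _; rewrite ordge0Mr// ordge0M// intr_ordge0.
by rewrite rpredD// ordge0Ml ?intr_ordge0// ordge0Mr.
Qed.

(** In a cover of least size no two representatives are congruent, since one of them could be
    dropped. *)
Lemma completion_finite_residue_at : finite_residue K.
Proof.
pose P q := `[< exists r : 'I_q -> K, res_cover r >].
have Pex : exists q, P q.
  by have [q [r hr]] := exists_res_cover; exists q; apply/asboolP; exists r.
case: (ex_minnP Pex) => q /asboolP[r [r0 rc]] qmin.
exists q, r; split=> // i j rij; apply/eqP/negPn/negP => nij.
case: q => [|q] in r r0 rc qmin i j rij nij *; first by case: (i).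
suff : P q by move=> /qmin; rewrite ltnn.
apply/asboolP; exists (fun k => r (lift j k)); split=> // x x0.
have [k hk] := rc x x0; have [k' kE|kj] := unliftP j k; first by exists k'; rewrite -kE.
have [i' iE|ij] := unliftP j i; last by rewrite ij eqxx in nij.
exists i'; rewrite -iE -(subrK (r k) x) -addrA rpredD// kj.
by rewrite -opprB rpredN.
Qed.

End FixChar.

Lemma completion_finite_residue : finite_residue K.
Proof. have [l lp l1] := residue_char; exact: completion_finite_residue_at lp l1. Qed.

End Completion.

(** * Isometries preserve Haar measure *)

Section UltrametricMeasure.
Variables (R : realType) (V : ptopologicalType) (N : int -> V -> V -> Prop).
Hypothesis N_sym : forall k x y, N k x y -> N k y x.
Hypothesis N_trans : forall k x y z, N k x y -> N k y z -> N k x z.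
Hypothesis N_le : forall j k x y, j <= k -> N k x y -> N j x y.
Hypothesis N_nbhs : forall x A, nbhs x A <-> exists k, forall y, N k x y -> A y.
Variables (I : countType) (D : I -> V).
Hypothesis N_dense : forall k x, exists i, N k x (D i).

(** [N k] stands for congruence at level [k]; working with such relations treats all matrices and
    the symmetric ones at once. *)
Definition ultraball k x : set V := [set y | N k x y].

Lemma ultraball_center k x y : N k x y -> ultraball k x = ultraball k y.
Proof.
move=> xy; apply/seteqP; split=> z /= h; first exact: N_trans (N_sym xy) h.
exact: N_trans xy h.
Qed.

Lemma ultra_openP (A : set V) :
  open A <-> forall x, A x -> exists k, forall y, N k x y -> A y.
Proof.
rewrite openE; split=> h x Ax; have := h x Ax.
  by rewrite /interior => /N_nbhs.
by move=> H; apply/N_nbhs.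
Qed.

Lemma ultraball_open k x : open (ultraball k x).
Proof. by apply/ultra_openP => y xy; exists k => z; exact: N_trans. Qed.

Definition ultraballs : set (set V) :=
  [set A | A = set0 \/ exists k x, A = ultraball k x].

(** Any point of a ball is a centre of it, so two balls that meet are nested. *)
Lemma ultraballs_setI : setI_closed ultraballs.
Proof.
move=> A B [->|[k [x ->]]]; first by rewrite set0I; left.
move=> [->|[l [y ->]]]; first by rewrite setI0; left.
have [[z [xz yz]]|nz] := pselect (exists z, N k x z /\ N l y z); last first.
  by left; apply/seteqP; split=> // z [h1 h2]; apply: nz; exists z.
rewrite (ultraball_center xz) (ultraball_center yz); right.
have [kl|lk] := leP k l.
  exists l, z; apply/seteqP; split=> [w []//|w h]; split=> //; exact: N_le kl h.
exists k, z; apply/seteqP; split=> [w []//|w h]; split=> //; exact: N_le (ltW lk) h.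
Qed.

(** An open set is the union of the balls it contains with centre in the countable dense family, and
    there are only countably many of these. *)
Lemma ultra_borelE : (@measurable _ (borelType V)) = <<s ultraballs >>.
Proof.
apply/seteqP; split; last first.
  apply: smallest_sub; first exact: sigma_algebra_measurable.
  move=> A [->|[k [x ->]]]; first exact: measurable0.
  by apply: sub_sigma_algebra; exact: ultraball_open.
apply: smallest_sub; first exact: smallest_sigma_algebra.
move=> A /ultra_openP Aop.
pose b (c : I * int) : set V :=
  if `[< ultraball c.2 (D c.1) `<=` A >] then ultraball c.2 (D c.1) else set0.
have -> : A = \bigcup_i (if unpickle i is Some c then b c else set0).
  apply/seteqP; split=> [x Ax|x [i _]].
    have [k kA] := Aop x Ax; have [i xi] := N_dense k x.
    exists (pickle (i, k)) => //; rewrite pickleK /b asboolT /=; first exact: N_sym.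
    by move=> y iy; apply: kA; exact: N_trans xi iy.
  by case: unpickle => // c; rewrite /b; case: asboolP => // h; exact: h.
apply: sigma_algebra_bigcup => i; apply: sub_sigma_algebra.
case: unpickle => [c|]; last by left.
by rewrite /b; case: asboolP => _; [right; exists c.2, (D c.1)|left].
Qed.

Variable mu : {measure set (borelType V) -> \bar R}.
Hypothesis mu_ball : forall k x y, mu (ultraball k x) = mu (ultraball k y).
Hypothesis mu_fin : forall x, (mu (ultraball 0 x) < +oo)%E.

(* By uniqueness of measures: balls form a pi-system generating the Borel sets. *)
Lemma ultra_isometry_measure (f g : V -> V) : cancel f g -> cancel g f ->
  (forall k x y, N k x y -> N k (f x) (f y)) ->
  (forall k x y, N k x y -> N k (g x) (g y)) ->
  forall A, @measurable _ (borelType V) A -> mu (f @^-1` A) = mu A.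
Proof.
move=> fK gK fN gN A mA.
have fball k x : f @^-1` (ultraball k x) = ultraball k (g x).
  apply/seteqP; split=> y /= h.
    by have := gN _ _ _ h; rewrite fK.
  by have := fN _ _ _ h; rewrite gK.
have mf : measurable_fun [set: borelType V] (f : borelType V -> borelType V).
  apply: (@measurability _ _ (borelType V) (borelType V) setT f ultraballs).
    exact: ultra_borelE.
  move=> _ [B [->|[k [x ->]]] <-]; rewrite setTI; first by rewrite preimage_set0.
  by rewrite fball ultra_borelE; apply: sub_sigma_algebra; right; exists k, (g x).
(* Countably many balls of level 0, each of finite mass, cover the space: the sigma-finiteness on
   which uniqueness of measures rests. *)
pose c i := if unpickle i is Some j then ultraball 0 (D j) else set0.
have cov : \bigcup_k c k = [set: V].
  apply/seteqP; split=> // x _; have [i xi] := N_dense 0 x.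
  by exists (pickle i) => //; rewrite /c pickleK; exact: N_sym.
apply/esym/(@measure_unique _ R (borelType V) ultraballs c ultra_borelE ultraballs_setI _ cov
  mu (measure_function_pushforward__canonical__measure_function_Measure mu mf)) => //.
- by move=> i; rewrite /c; case: unpickle => [j|]; [right; exists 0, (D j)|left].
- move=> B [->|[k [x ->]]]; first by rewrite !measure0.
  by rewrite /= /pushforward fball.
- move=> i; rewrite /c; case: unpickle => [j|]; first exact: mu_fin.
  by rewrite measure0.
Qed.

End UltrametricMeasure.

(** * Matrix spaces topologized by levels of congruence *)

Section Lattices.
Variable K : valuedFieldType.

Lemma mxOver_ordgeM j k m n r (A : 'M[K]_(m, n)) (B : 'M[K]_(n, r)) :
  A \is a mxOver (ordge j) -> B \is a mxOver (ordge k) -> A *m B \is a mxOver (ordge (j + k)).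
Proof.
move=> /mxOverP hA /mxOverP hB; apply/mxOverP => i l.
by rewrite mxE rpred_sum// => c _; exact: ordgeM.
Qed.

Lemma mxOver_ordgeMW j k l m n r (A : 'M[K]_(m, n)) (B : 'M[K]_(n, r)) : l <= j + k ->
  A \is a mxOver (ordge j) -> B \is a mxOver (ordge k) -> A *m B \is a mxOver (ordge l).
Proof.
move=> h hA hB; have /mxOverP hAB := mxOver_ordgeM hA hB.
by apply/mxOverP => a b; apply: ordgeW h _.
Qed.

Lemma mxOver_ordgeW j k m n (A : 'M[K]_(m, n)) : j <= k ->
  A \is a mxOver (ordge k) -> A \is a mxOver (ordge j).
Proof. by move=> jk /mxOverP hA; apply/mxOverP => a b; apply: ordgeW jk _. Qed.

Lemma mxOver_ordge_tr k m n (A : 'M[K]_(m, n)) :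
  (A^T \is a mxOver (ordge k)) = (A \is a mxOver (ordge k)).
Proof. by apply/mxOverP/mxOverP => h i j; have := h j i; rewrite ?mxE. Qed.

Lemma mxOver_ordge_ex m n (A : 'M[K]_(m, n)) : exists k, A \is a mxOver (ordge k).
Proof.
exists (- (\max_(c : 'I_m * 'I_n) `|ord (A c.1 c.2)|%N)%:Z); apply/mxOverP => i j.
apply: ordgeW (ordge_ord _).
have := @leq_bigmax _ (fun c : 'I_m * 'I_n => `|ord (A c.1 c.2)|%N) (i, j).
by rewrite /=; move: (\max_(c | _) _)%N (ord _) => ? ?; lia.
Qed.

Definition mx_near n k (X Y : 'M[K]_n) : Prop := X - Y \is a mxOver (ordge k).
Definition symmx_near n k (X Y : symmx K n) : Prop := mx_near k (val X) (val Y).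

Lemma mx_near_sym n k (X Y : 'M[K]_n) : mx_near k X Y -> mx_near k Y X.
Proof. by rewrite /mx_near -opprB rpredN. Qed.

Lemma mx_near_trans n k (X Y Z : 'M[K]_n) :
  mx_near k X Y -> mx_near k Y Z -> mx_near k X Z.
Proof. by rewrite /mx_near => h1 h2; rewrite -(subrK Y X) -addrA rpredD. Qed.

Lemma mx_near_le n j k (X Y : 'M[K]_n) : j <= k -> mx_near k X Y -> mx_near j X Y.
Proof. exact: mxOver_ordgeW. Qed.

Lemma nbhs_mxP n (X : 'M[K]_n) A :
  nbhs X A <-> exists k, forall Y, mx_near k X Y -> A Y.
Proof.
rewrite mx_ent_nbhsE; split.
  move=> [E [P Pent PE] EA].
  have /choice[k kP] (c : 'I_n * 'I_n) :
      exists k, forall x y, x - y \in ordge k -> P c.1 c.2 (x, y).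
    by apply/entourage_ordgeP; exact: Pent.
  exists (\max_c `|k c|%N)%:Z => Y /mxOverP XY; apply/EA/xsectionP/PE => i j /=.
  apply: (kP (i, j)); have := XY i j; rewrite !mxE; apply: ordgeW.
  have := @leq_bigmax _ (fun c => `|k c|%N) (i, j).
  by move: (\max_(c | _) _)%N (k _) => ? ?; lia.
move=> [k kA]; exists [set XY | mx_near k XY.1 XY.2].
  exists (fun _ _ => [set xy | xy.1 - xy.2 \in ordge k]).
    by move=> i j; apply/entourage_ordgeP; exists k.
  by move=> [M M'] /= h; apply/mxOverP => i j; rewrite !mxE; exact: h.
by move=> Y /xsectionP; exact: kA.
Qed.

Lemma nbhs_symmxP n (X : symmx K n) A :
  nbhs X A <-> exists k, forall Y, symmx_near k X Y -> A Y.
Proof.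
split=> [|[k kA]].
  rewrite nbhsE => -[B [[C Cop <-] CX] BA].
  have /nbhs_mxP[k kC] : nbhs (val X) C by exact: open_nbhs_nbhs.
  by exists k => Y XY; apply: BA; exact: kC.
have : nbhs X ((@symmx_val K n) @^-1` [set Y | mx_near k (val X) Y]).
  apply: (@initial_continuous _ _ (@symmx_val K n) X).
  by apply/nbhs_mxP; exists k.
by apply: filterS => Y; exact: kA.
Qed.

End Lattices.

Lemma subr_subDr (V : zmodType) (x y z : V) : x - (x - y + z) = y - z.
Proof. by rewrite opprD opprB addrA [x + _]addrC subrK. Qed.

(** * Haar measure on square and on symmetric matrices *)

Section HaarIsometry.
Variables (R : realType) (K : valuedFieldType) (n : nat).
Variable d : nat -> K.
Hypothesis d_dense : forall x k, exists i, x - d i \in ordge k.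

Let valB (x y : symmx K n) : val (x - y) = val x - val y.
Proof. exact: raddfB. Qed.

Let dmx (c : 'M[nat]_n) : 'M[K]_n := map_mx d c.

Let dmx_dense k (X : 'M[K]_n) : exists c, mx_near k X (dmx c).
Proof.
have /choice[h hE] (x : K) : exists i, x - d i \in ordge k by exact: d_dense.
by exists (map_mx h X); apply/mxOverP => i j; rewrite !mxE; exact: hE.
Qed.

(** A matrix that is not symmetric is replaced by 0. Density survives, because approximating equal
    entries by the same [d i] keeps a symmetric matrix symmetric. *)
Let dsymmx (c : 'M[nat]_n) : symmx K n := insubd 0 (dmx c).

Let dsymmx_dense k (X : symmx K n) : exists c, symmx_near k X (dsymmx c).
Proof.
have /choice[h hE] (x : K) : exists i, x - d i \in ordge k by exact: d_dense.
exists (map_mx h (val X)); rewrite /symmx_near /dsymmx insubdK; last first.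
  rewrite unfold_in; apply/eqP/matrixP => i j; rewrite !mxE.
  by have /eqP/matrixP/(_ i j) := symmx_sym X; rewrite mxE => ->.
by apply/mxOverP => i j; rewrite !mxE; exact: hE.
Qed.

Lemma mx_haar_isometry (mu : {measure set (borelType 'M[K]_n) -> \bar R})
    (f g : 'M[K]_n -> 'M[K]_n) :
  is_haar (@integral_mx K n) mu -> cancel f g -> cancel g f ->
  (forall k x y, mx_near k x y -> mx_near k (f x) (f y)) ->
  (forall k x y, mx_near k x y -> mx_near k (g x) (g y)) ->
  forall A, open A -> mu (f @^-1` A) = mu A.
Proof.
move=> [mu1 mut] fK gK fN gN A Aop.
pose B k (x : 'M[K]_n) := ultraball (@mx_near K n) k x.
have Bo k x : open (B k x).
  by apply: ultraball_open; [exact: mx_near_trans|exact: nbhs_mxP].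
have tr k x y : [set x - y + z | z in B k y] = B k x.
  apply/seteqP; split=> [_ [z yz <-]|z xz].
    by rewrite /B /ultraball /= /mx_near subr_subDr.
  exists (y - x + z); last by rewrite -(opprB y x) addKr.
  by rewrite /B /ultraball /= /mx_near subr_subDr.
have mut' k x y : mu (B k x) = mu (B k y).
  by rewrite -(tr k x y); apply: mut; apply: sub_sigma_algebra; exact: Bo.
have L0 : @integral_mx K n = B 0 0.
  apply/seteqP; split=> x.
    by rewrite /B /ultraball /= /mx_near sub0r rpredN.
  by rewrite /B /ultraball /= /mx_near sub0r rpredN.
apply: (@ultra_isometry_measure R _ (@mx_near K n) _ _ _ _ _ dmx _ mu _ _ f g fK gK fN gN).
- exact: mx_near_sym.
- exact: mx_near_trans.
- exact: mx_near_le.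
- exact: nbhs_mxP.
- exact: dmx_dense.
- exact: mut'.
- by move=> x; rewrite -/(B 0 x) (mut' 0 x 0) -L0 mu1 ltry.
- exact: sub_sigma_algebra.
Qed.

Lemma symmx_haar_isometry (mu : {measure set (borelType (symmx K n)) -> \bar R})
    (f g : symmx K n -> symmx K n) :
  is_haar (@integral_symmx K n) mu -> cancel f g -> cancel g f ->
  (forall k x y, symmx_near k x y -> symmx_near k (f x) (f y)) ->
  (forall k x y, symmx_near k x y -> symmx_near k (g x) (g y)) ->
  forall A, open A -> mu (f @^-1` A) = mu A.
Proof.
move=> [mu1 mut] fK gK fN gN A Aop.
pose B k (x : symmx K n) := ultraball (@symmx_near K n) k x.
have Bo k x : open (B k x).
  by apply: ultraball_open; [move=> ? ? ? ?; exact: mx_near_trans|exact: nbhs_symmxP].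
have tr k x y : [set x - y + z | z in B k y] = B k x.
  apply/seteqP; split=> [_ [z yz <-]|z xz].
    by move: yz; rewrite /B /ultraball /= /symmx_near /mx_near -!valB subr_subDr.
  exists (y - x + z); last by rewrite -(opprB y x) addKr.
  by move: xz; rewrite /B /ultraball /= /symmx_near /mx_near -!valB subr_subDr.
have mut' k x y : mu (B k x) = mu (B k y).
  by rewrite -(tr k x y); apply: mut; apply: sub_sigma_algebra; exact: Bo.
have L0 : @integral_symmx K n = B 0 0.
  apply/seteqP; split=> x.
    by rewrite /B /ultraball /= /symmx_near /mx_near (raddf0 val) sub0r rpredN.
  by rewrite /B /ultraball /= /symmx_near /mx_near (raddf0 val) sub0r rpredN.
apply: (@ultra_isometry_measure R _ (@symmx_near K n) _ _ _ _ _ dsymmx _ mu _ _ f g fK gK fN gN).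
- by move=> ? ? ?; exact: mx_near_sym.
- by move=> ? ? ? ?; exact: mx_near_trans.
- by move=> ? ? ? ?; exact: mx_near_le.
- exact: nbhs_symmxP.
- exact: dsymmx_dense.
- exact: mut'.
- by move=> x; rewrite -/(B 0 x) (mut' 0 x 0) -L0 mu1 ltry.
- exact: sub_sigma_algebra.
Qed.

End HaarIsometry.

(** * Invariance of the local density *)

Lemma symmx_congr_near (K : valuedFieldType) n (G : symmx K n) (Y : 'M[K]_n) k :
  exists l, forall Y', mx_near l Y Y' -> symmx_near k (symmx_congr G Y) (symmx_congr G Y').
Proof.
have [a Ya] := mxOver_ordge_ex Y; have [g Gg] := mxOver_ordge_ex (val G).
(* The level is at least [a], so that [Y'] obeys the bound of [Y], and at least [k - g - a], which
   the two error terms require. *)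
exists (`|a| + `|k - g - a|) => Y' D.
have Dt : (Y - Y')^T \is a mxOver (ordge (`|a| + `|k - g - a|)) by rewrite mxOver_ordge_tr.
have Da : Y - Y' \is a mxOver (ordge a) by apply: mxOver_ordgeW D; lia.
have Y't : Y'^T \is a mxOver (ordge a) by rewrite mxOver_ordge_tr -(subKr Y Y') rpredB.
rewrite /symmx_near /mx_near /=.
have -> : Y^T *m G *m Y - Y'^T *m G *m Y' =
    (Y - Y')^T *m val G *m Y + Y'^T *m val G *m (Y - Y').
  by rewrite linearB /= !mulmxBl mulmxBr addrA subrK.
rewrite rpredD//.
  by apply: (mxOver_ordgeMW _ (mxOver_ordgeM Dt Gg) Ya); lia.
by apply: (mxOver_ordgeMW _ (mxOver_ordgeM Y't Gg) D); lia.
Qed.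

(** The set measured in the numerator of a local density is thus open, so that invariance under
    isometries applies to it. *)
Lemma open_congr_preimage (K : valuedFieldType) n (G : symmx K n) (U : set (symmx K n)) :
  open U -> open (@integral_mx K n `&` [set X | U (symmx_congr G X)]).
Proof.
have mxP := ultra_openP (@nbhs_mxP K n).
have symP := ultra_openP (@nbhs_symmxP K n).
move=> /symP Uop; apply/mxP => X [LX UX].
have [k kU] := Uop _ UX; have [l hl] := symmx_congr_near G X k.
exists (`|l|) => Y XY; split; last first.
  by apply/kU/hl; apply: mx_near_le XY; lia.
have XY0 : X - Y \is a mxOver (ordge 0) by apply: mxOver_ordgeW XY; lia.
by rewrite /integral_mx /= -(subKr X Y); exact: rpredB.
Qed.

Section DensityInvariance.
Variables (R : realType) (K : valuedFieldType) (n : nat).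
Variables (muM : {measure set (borelType 'M[K]_n) -> \bar R}).
Variables (muS : {measure set (borelType (symmx K n)) -> \bar R}).

Let nearE (f : symmx K n -> symmx K n) :=
  forall k x y, symmx_near k x y -> symmx_near k (f x) (f y).

Let ratio (G : symmx K n) (U : set (symmx K n)) : R :=
  fine (muM (@integral_mx K n `&` [set X | U (symmx_congr G X)])) / fine (muS U).

Let ratio_filter (G : symmx K n) : set_system R :=
  ratio G @ within [set U | open U] (powerset_filter_from (nbhs G)).

Lemma near_preimage_open (f : symmx K n -> symmx K n) : nearE f ->
  forall U, open U -> open (f @^-1` U).
Proof.
have symP := ultra_openP (@nbhs_symmxP K n).
move=> fN U /symP Uop; apply/symP => x fx.
have [k kU] := Uop _ fx; exists k => y xy; apply: kU; exact: fN.
Qed.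

Lemma near_preimage_nbhs (f : symmx K n -> symmx K n) : nearE f ->
  forall x U, nbhs (f x) U -> nbhs x (f @^-1` U).
Proof.
move=> fN x U /nbhs_symmxP[k kU]; apply/nbhs_symmxP; exists k => y xy.
by apply: kU; exact: fN.
Qed.

(** Pulling back along [f] turns small open neighborhoods of [G'] into small open neighborhoods of
    [G]. Comparing filters instead of limits gives equality of the [lim] terms without discussing
    convergence. *)
Lemma ratio_filter_sub (f g : symmx K n -> symmx K n) (G G' : symmx K n) :
  cancel f g -> cancel g f -> nearE f -> nearE g -> G' = f G ->
  (forall U, open U -> ratio G' U = ratio G (f @^-1` U)) ->
  ratio_filter G `<=` ratio_filter G'.
Proof.
move=> fK gK fN gN -> rE B [M [MG Mdown [E0 ME0]] MP].
exists [set U | M (f @^-1` U)].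
  split=> [U /MG h|U1 U2 /= MU1 hU2 U21|].
  - have -> : U = g @^-1` (f @^-1` U) by apply/seteqP; split=> x /=; rewrite gK.
    by apply: near_preimage_nbhs => //; rewrite fK.
  - apply: (Mdown _ _ MU1); first exact: near_preimage_nbhs.
    by move=> x; exact: U21.
  - exists (g @^-1` E0) => /=.
    by have -> : f @^-1` (g @^-1` E0) = E0 by apply/seteqP; split=> x /=; rewrite fK.
move=> U /= MU Uop; rewrite /preimage /= rE//.
by apply: (MP _ MU); exact: near_preimage_open.
Qed.

Lemma local_density_isometry (f g : symmx K n -> symmx K n) (G G' : symmx K n) :
  cancel f g -> cancel g f -> nearE f -> nearE g -> G' = f G ->
  (forall U, open U -> ratio G' U = ratio G (f @^-1` U)) ->
  local_density muM muS G' = local_density muM muS G.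
Proof.
move=> fK gK fN gN G'E rE.
suff E : ratio_filter G' = ratio_filter G.
  exact: (congr1 (fun H : set_system R => 2^-1 * lim H) E).
apply/seteqP; split; last exact: (ratio_filter_sub fK gK fN gN G'E rE).
apply: (ratio_filter_sub gK fK gN fN); first by rewrite G'E fK.
move=> U Uop; rewrite rE; last exact: near_preimage_open.
by congr (ratio _ _); apply/seteqP; split=> x /=; rewrite fK.
Qed.

Variable d : nat -> K.
Hypothesis d_dense : forall x k, exists i, x - d i \in ordge k.
Hypothesis muM_haar : is_haar (@integral_mx K n) muM.
Hypothesis muS_haar : is_haar (@integral_symmx K n) muS.

Lemma symmx_scale_subproof (u : K) (G : symmx K n) : u *: val G \in sym_mx.
Proof. by rewrite unfold_in linearZ /= (eqP (symmx_sym G)). Qed.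

Definition symmx_scale (u : K) (G : symmx K n) : symmx K n :=
  SymMx (symmx_scale_subproof u G).

Lemma symmx_scaleK u : u != 0 -> cancel (symmx_scale u) (symmx_scale u^-1).
Proof. by move=> u0 G; apply: val_inj; rewrite /= scalerA mulVf// scale1r. Qed.

Lemma symmx_scale_near u : u \in val_unit K -> nearE (symmx_scale u).
Proof.
move=> uu k x y /mxOverP xy; apply/mxOverP => i j.
by rewrite -scalerBr mxE ordge0Ml// unit_ordge0.
Qed.

(** Scaling commutes with [G |-> X^t G X], so the numerators are masses of the same set of [X]; the
    denominators agree because scaling by a unit is an isometry of the symmetric matrices. *)
Lemma local_density_scale u G : u \in val_unit K ->
  local_density muM muS (symmx_scale u G) = local_density muM muS G.
Proof.
move=> uu; have u0 := unit_neq0 uu; have uV := unitV uu.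
have fK := symmx_scaleK u0.
have gK : cancel (symmx_scale u^-1) (symmx_scale u).
  by have := symmx_scaleK (invr_neq0 u0); rewrite invrK.
have fN := symmx_scale_near uu; have gN := symmx_scale_near uV.
apply: (local_density_isometry fK gK) => // U Uop; rewrite /ratio.
rewrite (symmx_haar_isometry d_dense muS_haar fK gK fN gN Uop); congr (fine (muM (_ `&` _)) / _).
apply/funext => X /=; congr U; apply: val_inj => /=.
by rewrite -scalemxAr -scalemxAl.
Qed.

Lemma symmx_congr_near_map (T : 'M[K]_n) : T \is a mxOver (val_ring K) ->
  nearE (fun H => symmx_congr H T).
Proof.
move=> iT k x y xy; rewrite /symmx_near /mx_near /= -mulmxBl -mulmxBr.
have iT0 : T \is a mxOver (ordge 0) by [].
have iTt : T^T \is a mxOver (ordge 0) by rewrite mxOver_ordge_tr.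
by apply: (mxOver_ordgeMW _ (mxOver_ordgeM iTt xy) iT0); lia.
Qed.

Lemma symmx_congrK (T : 'M[K]_n) : T \in unitmx ->
  cancel (fun H : symmx K n => symmx_congr H T) (fun H => symmx_congr H (invmx T)).
Proof.
move=> uT H; apply: val_inj => /=.
by rewrite trmx_inv !mulmxA mulVmx ?unitmx_tr// mul1mx mulmxK.
Qed.

Lemma mx_conj_near (S T : 'M[K]_n) : S \is a mxOver (val_ring K) ->
  T \is a mxOver (val_ring K) ->
  forall k x y, mx_near k x y -> mx_near k (S *m x *m T) (S *m y *m T).
Proof.
move=> iS iT k x y xy; rewrite /mx_near -mulmxBl -mulmxBr.
have iS0 : S \is a mxOver (ordge 0) by [].
have iT0 : T \is a mxOver (ordge 0) by [].
by apply: (mxOver_ordgeMW _ (mxOver_ordgeM iS0 xy) iT0); lia.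
Qed.

(* Conjugation by [T] on [M_n] matches the change of basis [H |-> T^t H T]. *)
Lemma local_density_congr (T : 'M[K]_n) G : integral_GL T ->
  local_density muM muS (symmx_congr G T) = local_density muM muS G.
Proof.
move=> [uT iT iV].
have fK := symmx_congrK uT.
have gK : cancel (fun H : symmx K n => symmx_congr H (invmx T)) (fun H => symmx_congr H T).
  by have := @symmx_congrK (invmx T); rewrite unitmx_inv invmxK; exact.
have fN := symmx_congr_near_map iT; have gN := symmx_congr_near_map iV.
pose t X := T *m X *m invmx T; pose t' X := invmx T *m X *m T.
have tK : cancel t t' by move=> X; rewrite /t /t' !mulmxA mulVmx// mul1mx mulmxKV.
have t'K : cancel t' t by move=> X; rewrite /t /t' !mulmxA mulmxV// mul1mx mulmxK.
have tN := mx_conj_near iT iV; have t'N := mx_conj_near iV iT.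
apply: (local_density_isometry fK gK) => // U Uop; rewrite /ratio.
rewrite (symmx_haar_isometry d_dense muS_haar fK gK fN gN Uop); congr (fine _ / _).
pose A := @integral_mx K n `&` 
  [set X | ((fun H => symmx_congr H T) @^-1` U) (symmx_congr G X)].
have Aop : open A by apply/open_congr_preimage/near_preimage_open.
rewrite -(mx_haar_isometry d_dense muM_haar tK t'K tN t'N Aop); congr (muM _).
have tL X : integral_mx X -> integral_mx (t X).
  by rewrite /integral_mx /= => h; apply: mxOverM => //; exact: mxOverM.
have t'L X : integral_mx (t X) -> integral_mx X.
  move=> h; rewrite -(tK X) /integral_mx /=.
  by apply: mxOverM => //; exact: mxOverM.
have E X : symmx_congr (symmx_congr G T) X = symmx_congr (symmx_congr G (t X)) T.
  apply: val_inj; rewrite /= /t !trmx_mul trmx_inv !mulmxA.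
  rewrite -[in RHS](mulmxA _ (invmx T) T) mulVmx// mulmx1.
  by rewrite mulmxV ?unitmx_tr// mul1mx.
by apply/seteqP; split=> X /= []; rewrite E => h1 h2; split=> //; [exact: tL|exact: t'L].
Qed.

End DensityInvariance.

(** * Scaling of square classes, forms and genera *)

Local Open Scope quotient_scope.

Section SquareClassArithmetic.
Variable K : valuedFieldType.
Implicit Types (x y u : nonzero K) (S T : SqCl K).

Lemma sqclP x y : reflect (sqcl x = sqcl y) (sqcl_rel x y).
Proof. exact: eqmodP. Qed.

Lemma sqcl_eq x y (w : K) : w \in val_unit K -> val y = val x * w ^+ 2 -> sqcl x = sqcl y.
Proof. by move=> uw yE; apply/sqclP/asboolP; exists w. Qed.

Lemma sqcl_repr S : sqcl (repr S) = S.
Proof. exact: reprK. Qed.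

Lemma repr_sqcl x : exists2 w, w \in val_unit K & val (repr (sqcl x)) = val x * w ^+ 2.
Proof. by apply/asboolP/sqclP; rewrite sqcl_repr. Qed.

Lemma sqcl_mulE x y : sqcl_mul (sqcl x) (sqcl y) = sqcl (nz_mul x y).
Proof.
have [w uw xE] := repr_sqcl x; have [v uv yE] := repr_sqcl y.
apply/esym/(@sqcl_eq _ _ (w * v)); first exact: unitM.
by rewrite /= xE yE exprMn mulrACA.
Qed.

Lemma sqcl_mulA S T U : sqcl_mul S (sqcl_mul T U) = sqcl_mul (sqcl_mul S T) U.
Proof.
rewrite -[S]sqcl_repr -[T]sqcl_repr -[U]sqcl_repr !sqcl_mulE; congr sqcl.
by apply: val_inj; rewrite /= mulrA.
Qed.

Lemma sqcl_ordE x : sqcl_ord (sqcl x) = ord (val x).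
Proof.
rewrite /sqcl_ord; have [w uw ->] := repr_sqcl x; have w0 := unit_neq0 uw.
by rewrite ordM ?expf_neq0 ?(valP x)// ord_exp// (unit_ord uw) mul0r addr0.
Qed.

Lemma sqcl_ord_unit u S : val u \in val_unit K -> sqcl_ord (sqcl_mul (sqcl u) S) = sqcl_ord S.
Proof.
move=> uu; rewrite -[S]sqcl_repr sqcl_mulE !sqcl_ordE /=.
by rewrite ordM ?(valP u) ?(valP (repr S))// (unit_ord uu) add0r.
Qed.

Lemma normalized_rep_unit pi u S : val u \in val_unit K ->
  normalized_rep pi (sqcl_mul (sqcl u) S) = sqcl_mul (sqcl u) (normalized_rep pi S).
Proof. by move=> uu; rewrite /normalized_rep sqcl_ord_unit// sqcl_mulA. Qed.

End SquareClassArithmetic.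

Section FormScaling.
Variables (K : valuedFieldType) (n : nat).
Implicit Types (Q : qform K n) (u : nonzero K).

Lemma qform_scale_subproof u Q : \det (hessian (symmx_scale (val u) (val Q))) != 0.
Proof.
have -> : hessian (symmx_scale (val u) (val Q)) = val u *: hessian (val Q).
  by rewrite /hessian /= !scalerA mulrC.
by rewrite detZ mulf_neq0 ?expf_neq0 ?(valP u) ?(valP Q).
Qed.

Definition qform_scale u Q : qform K n :=
  exist (fun G : symmx K n => \det (hessian G) != 0) _ (qform_scale_subproof u Q).

Lemma gram_scale u Q : gram (qform_scale u Q) = val u *: gram Q.
Proof. by []. Qed.

Lemma qform_inj Q Q' : gram Q = gram Q' -> Q = Q'.
Proof. by move=> h; do 2!apply: val_inj. Qed.

Lemma qeval_scale u Q x : qeval (qform_scale u Q) x = val u * qeval Q x.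
Proof. by rewrite /qeval gram_scale -scalemxAr -scalemxAl mxE. Qed.

Lemma equiv_scale u Q Q' :
  integral_equiv Q Q' -> integral_equiv (qform_scale u Q) (qform_scale u Q').
Proof.
move=> /asboolP[T iT QE]; apply/asboolP; exists T => //.
by rewrite !gram_scale QE -scalemxAr -scalemxAl.
Qed.

Lemma primitive_equiv Q Q' : integral_equiv Q Q' -> primitive Q -> primitive Q'.
Proof.
move=> /asboolP[T [uT iT iV] QE].
have QE' x : qeval Q' x = qeval Q (T *m x) by rewrite /qeval QE trmx_mul !mulmxA.
move=> [Qint [m [c [x [cx cE]]]]]; split.
  by move=> y iy; rewrite QE'; apply: Qint; exact: mxOverM.
exists m, c, (fun i => invmx T *m x i); split.
  by move=> i; have [? ?] := cx i; split=> //; exact: mxOverM.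
by rewrite -cE; apply: eq_bigr => i _; rewrite QE' mulKVmx.
Qed.

Lemma primitive_scale u Q : val u \in val_unit K -> primitive Q -> primitive (qform_scale u Q).
Proof.
move=> uu [Qint [m [c [x [cx cE]]]]]; split.
  move=> y iy; rewrite qeval_scale; apply: rpredM; last exact: Qint.
  by rewrite ordge0E unit_ordge0.
exists m, (fun i => c i / val u), x; split.
  move=> i; have [? ?] := cx i; split=> //.
  by rewrite rpredM// ordge0E unit_ordge0// unitV.
by rewrite -cE; apply: eq_bigr => i _; rewrite qeval_scale mulrA divfK// unit_neq0.
Qed.

Lemma integral_GL_det (T : 'M[K]_n) : integral_GL T -> \det T \in val_unit K.
Proof.
have detO (M : 'M[K]_n) : M \is a mxOver (val_ring K) -> \det M \in ordge 0.
  move=> /mxOverP h; rewrite -ordge0E /determinant rpred_sum// => s _.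
  by rewrite rpredM ?rpredX ?rpredN ?rpred1// rpred_prod.
move=> [uT /detO d1 /detO d2]; have d0 : \det T != 0 by rewrite -unitfE -unitmxE.
move: d1 d2; rewrite det_inv ordgeE// => d1; rewrite ordgeE ?invr_neq0// ordV// oppr_ge0 => d2.
by apply/unitP; split=> //; apply/eqP; rewrite eq_le d2.
Qed.

Lemma hessian_det_equiv Q Q' : integral_equiv Q Q' -> hessian_det Q = hessian_det Q'.
Proof.
move=> /asboolP[T iT QE]; apply: (sqcl_eq (integral_GL_det iT)) => /=.
rewrite /hessian -[val (val Q')]/(gram Q') QE -[val (val Q)]/(gram Q) !detZ !det_mulmx det_tr.
by ring.
Qed.

Lemma hessian_det_scale u Q : odd n -> val u \in val_unit K ->
  hessian_det (qform_scale u Q) = sqcl_mul (sqcl u) (hessian_det Q).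
Proof.
move=> on uu; rewrite /hessian_det sqcl_mulE; apply/esym.
have uX k : val u ^+ k \in val_unit K.
  elim: k => [|k IH]; last by rewrite exprS unitM.
  by apply/unitP; rewrite expr0 oner_neq0 Defs.ord1.
apply: (sqcl_eq (uX n./2)) => /=.
rewrite /hessian /= !detZ.
have -> : val u ^+ n = val u * (val u ^+ n./2) ^+ 2.
  by rewrite -exprM -exprS muln2 -add1n -[X in _ ^+ X = _]odd_double_half on.
by rewrite -[sval u]/(val u); ring.
Qed.

Lemma is_hasse_equiv Q Q' e : integral_equiv Q Q' -> is_hasse Q e -> is_hasse Q' e.
Proof.
move=> /asboolP[S [uS _ _] QE] [a [T [uT TE ->]]]; exists a, (invmx S *m T); split=> //.
  by rewrite unitmx_mul unitmx_inv uS.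
rewrite QE trmx_mul trmx_inv !mulmxA mulmxKV ?unitmx_tr// -TE.
by congr (_ *m _); rewrite -!mulmxA mulmxV// mulmx1.
Qed.

Lemma diag_neq0 Q (a : 'rV[K]_n) T : T \in unitmx -> T^T *m gram Q *m T = diag_mx a ->
  forall i, a 0 i != 0.
Proof.
move=> uT TE i; have dT : \det T != 0 by rewrite -unitfE -unitmxE.
have dQ : \det (gram Q) != 0.
  have := valP Q; rewrite /= /hessian detZ mulf_eq0 negb_or => /andP[_]; exact.
have : \det (diag_mx a) != 0 by rewrite -TE !det_mulmx det_tr !mulf_neq0.
by rewrite det_diag (bigD1 i)//= mulf_eq0 negb_or => /andP[].
Qed.

Hypothesis two0 : (2 : K) != 0.
Hypothesis Kcomplete : forall A : set_system K, ProperFilter A -> cauchy A -> cvg A.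
Hypothesis Kfin : finite_residue K.
Hypothesis Kunif : exists2 p : K, p != 0 & ord p = 1.

(** Each diagonalization of one form is carried to a diagonalization of the other by the same [T].
    The sign is its own inverse, so it may be put on either side. *)
Lemma is_hasse_scale u Q e : odd n ->
  is_hasse (qform_scale u Q) e <-> is_hasse Q (hilbert (val u) (val u) ^+ 'C(n, 2) * e).
Proof.
move=> on; have u0 := valP u; set s := _ ^+ _.
have s2 : s * s = 1 by rewrite /s -exprMn hilbert_sqr expr1n.
have scaleT (a : 'rV[K]_n) T :
    (T^T *m gram (qform_scale u Q) *m T = val u *: diag_mx a) <->
    (T^T *m gram Q *m T = diag_mx a).
  rewrite gram_scale -scalemxAr -scalemxAl; split=> [/(scalerI _)->//|->//].
split=> [[a [T [uT TE eE]]]|[a [T [uT TE eE]]]].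
  pose b := (val u)^-1 *: a.
  have aE : a = val u *: b by rewrite scalerA divff// scale1r.
  have aE' i : a 0 i = val u * b 0 i by rewrite {1}aE mxE.
  have TE' : T^T *m gram Q *m T = diag_mx b by apply/scaleT; rewrite TE {1}aE linearZ.
  exists b, T; split=> //; rewrite eE.
  under eq_bigr => i _ do under eq_bigr => j _ do rewrite !aE'.
  rewrite (hasse_scale two0 Kcomplete Kfin Kunif)//; first by rewrite mulrA s2 mul1r.
  exact: diag_neq0 uT TE'.
have dE : diag_mx (val u *: a) = val u *: diag_mx a by rewrite linearZ.
exists (val u *: a), T; split=> //; first by rewrite dE; apply/scaleT.
have aE i : (val u *: a) 0 i = val u * a 0 i by rewrite mxE.
under eq_bigr => i _ do under eq_bigr => j _ do rewrite !aE.
rewrite (hasse_scale two0 Kcomplete Kfin Kunif)//; last exact: diag_neq0 uT TE.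
by rewrite -eE mulrA s2 mul1r.
Qed.

End FormScaling.

(** * The action of units on genera and on the weighted sums *)

Section GenusScaling.
Variables (R : realType) (K : valuedFieldType) (n : nat).
Variables (muM : {measure set (borelType 'M[K]_n) -> \bar R}).
Variables (muS : {measure set (borelType (symmx K n)) -> \bar R}).
Hypothesis muM_haar : is_haar (@integral_mx K n) muM.
Hypothesis muS_haar : is_haar (@integral_symmx K n) muS.
Variable d : nat -> K.
Hypothesis d_dense : forall x k, exists i, x - d i \in ordge k.
Hypothesis two0 : (2 : K) != 0.
Hypothesis Kcomplete : forall A : set_system K, ProperFilter A -> cauchy A -> cvg A.
Hypothesis Kfin : finite_residue K.
Hypothesis Kunif : exists2 p : K, p != 0 & ord p = 1.
Hypothesis n_odd : odd n.
Implicit Types (u : nonzero K) (S : SqCl K) (g : local_genus K n).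

Definition genus (Q : qform K n) : local_genus K n := \pi_(local_genus K n) Q.

Lemma genusP Q Q' : reflect (genus Q = genus Q') (integral_equiv Q Q').
Proof. exact: eqmodP. Qed.

Lemma genus_repr g : genus (repr g) = g.
Proof. exact: reprK. Qed.

Lemma repr_genus Q : integral_equiv (repr (genus Q)) Q.
Proof. by apply/genusP; rewrite genus_repr. Qed.

(** Any form of the genus may replace the representative chosen by [repr], by invariance under
    integral change of basis. *)
Lemma genus_densityE Q : genus_density muM muS (genus Q) = local_density muM muS (val Q).
Proof.
rewrite /genus_density; have := repr_genus Q; rewrite integral_equiv_sym => /asboolP[T iT QE].
rewrite -(local_density_congr d_dense muM_haar muS_haar (val Q) iT).
by congr local_density; exact: val_inj.
Qed.

Definition genus_scale u g : local_genus K n := genus (qform_scale u (repr g)).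

Lemma genus_scale_density u g : val u \in val_unit K ->
  genus_density muM muS (genus_scale u g) = genus_density muM muS g.
Proof.
by move=> uu; rewrite genus_densityE /=; exact: local_density_scale.
Qed.

Definition nz_inv u : nonzero K := exist _ (val u)^-1 (invr_neq0 (valP u)).

Lemma nz_invK u : nz_inv (nz_inv u) = u.
Proof. by apply: val_inj; rewrite /= invrK. Qed.

Lemma genus_scaleK u : cancel (genus_scale u) (genus_scale (nz_inv u)).
Proof.
move=> g; rewrite -[RHS]genus_repr; apply/genusP.
have -> : repr g = qform_scale (nz_inv u) (qform_scale u (repr g)).
  by apply: qform_inj; rewrite !gram_scale scalerA mulVf ?scale1r// (valP u).
exact/equiv_scale/repr_genus.
Qed.

Lemma genus_scale_primitive u S g : val u \in val_unit K -> primitive_genera S g ->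
  primitive_genera (sqcl_mul (sqcl u) S) (genus_scale u g).
Proof.
move=> uu [gp gS]; have E := repr_genus (qform_scale u (repr g)); split.
  rewrite integral_equiv_sym in E.
  by apply: primitive_equiv E _; exact: primitive_scale.
by rewrite (hessian_det_equiv E) hessian_det_scale// gS.
Qed.

Lemma nz_inv_unit u : val u \in val_unit K -> val (nz_inv u) \in val_unit K.
Proof. exact: unitV. Qed.

Lemma sqcl_mulK u S : sqcl_mul (sqcl (nz_inv u)) (sqcl_mul (sqcl u) S) = S.
Proof.
rewrite -[S]sqcl_repr !sqcl_mulE; congr sqcl; apply: val_inj.
by rewrite /= mulrA mulVf ?mul1r// (valP u).
Qed.

(** The two sets of densities coincide, and [get] depends only on the set. *)
Lemma normalized_density_scale u S : val u \in val_unit K ->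
  normalized_density muM muS (sqcl_mul (sqcl u) S) = normalized_density muM muS S.
Proof.
move=> uu; rewrite /normalized_density; congr get; apply/seteqP; split=> _ [g gS <-].
  exists (genus_scale (nz_inv u) g).
    by rewrite -[S](sqcl_mulK u); apply: genus_scale_primitive => //; exact: nz_inv_unit.
  by apply: genus_scale_density; exact: nz_inv_unit.
by exists (genus_scale u g); [exact: genus_scale_primitive|exact: genus_scale_density].
Qed.

Let sgn u : int := hilbert (val u) (val u) ^+ 'C(n, 2).

Lemma is_hasse_genus_scale u g e :
  is_hasse (repr (genus_scale u g)) e <-> is_hasse (repr g) (sgn u * e).
Proof.
rewrite -(is_hasse_scale two0 Kcomplete Kfin Kunif)//.
have E := repr_genus (qform_scale u (repr g)).
split; first exact: is_hasse_equiv E.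
by rewrite integral_equiv_sym in E; exact: is_hasse_equiv E.
Qed.

(** Scaling by [u] reindexes the sum and leaves each term unchanged; scaling by the inverse unit
    shows that every genus is reached. *)
Lemma Mstar_scale pi e u S : val u \in val_unit K ->
  Mstar muM muS pi e (sqcl_mul (sqcl u) S) = Mstar muM muS pi (sgn u * e) S.
Proof.
move=> uu; rewrite /Mstar normalized_rep_unit// normalized_density_scale//.
rewrite (@reindex_fsbig _ _ _ _ _ (genus_scale u)
  (primitive_genera S `&` [set g | is_hasse (repr g) (sgn u * e)])).
  by apply: eq_fsbigr => g _; rewrite genus_scale_density.
split=> [g /= [gS ge]|g g' _ _|g /= [gS ge]].
- by split; [exact: genus_scale_primitive|exact/is_hasse_genus_scale].
- exact: (can_inj (genus_scaleK u)).
have gE : genus_scale u (genus_scale (nz_inv u) g) = g.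
  by have := genus_scaleK (nz_inv u) g; rewrite nz_invK.
exists (genus_scale (nz_inv u) g) => //; split.
  by rewrite -[S](sqcl_mulK u); apply: genus_scale_primitive => //; exact: nz_inv_unit.
by apply: (is_hasse_genus_scale u _ e).1; rewrite gE.
Qed.

Lemma sgn_cases u : sgn u = 1 \/ sgn u = -1.
Proof.
have : sgn u * sgn u = 1 by rewrite /sgn -exprMn hilbert_sqr expr1n.
by move/eqP; rewrite -expr2 sqrf_eq1 => /orP[] /eqP; [left|right].
Qed.

Lemma Astar_scale pi u S : val u \in val_unit K ->
  Astar muM muS pi (sqcl_mul (sqcl u) S) = Astar muM muS pi S.
Proof.
move=> uu; rewrite /Astar !Mstar_scale//.
by case: (sgn_cases u) => ->; rewrite ?mul1r// mulN1r mulrNN mulr1 addrC.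
Qed.

Lemma Bstar_scale pi u S : val u \in val_unit K ->
  Bstar muM muS pi (sqcl_mul (sqcl u) S) =
  (hilbert (val u) (val u) ^+ 'C(n, 2))%:~R * Bstar muM muS pi S.
Proof.
move=> uu; rewrite /Bstar !Mstar_scale// -/(sgn u).
case: (sgn_cases u) => ->; first by rewrite !mul1r.
by rewrite mulN1r mulrNN mulr1 mulrN1z mulN1r opprB.
Qed.

End GenusScaling.

Local Close Scope quotient_scope.

Theorem theorem5p7 (R : realType) (F : fieldExtType rat)
  (p : prime_idealr (ring_of_integers F))
  (p_neq0 : exists2 a : ring_of_integers F, a != 0 & a \in p)
  (K : valuedFieldType) (iota : {rmorphism F -> K})
  (K_completion : is_completion p iota)
  (n : nat) (n_odd : odd n)
  (muM : {measure set (borelType 'M[K]_n) -> \bar R})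
  (muM_haar : is_haar (@integral_mx K n) muM)
  (muS : {measure set (borelType (symmx K n)) -> \bar R})
  (muS_haar : is_haar (@integral_symmx K n) muS)
  (pi_p : SqCl K) (pi_p_ord : sqcl_ord pi_p = 1)
  (u : nonzero K) (u_unit : val u \in val_unit K) (S : SqCl K) :
  Astar muM muS pi_p (sqcl_mul (sqcl u) S) = Astar muM muS pi_p S
  /\ (n = 1 %[mod 4] ->
      Bstar muM muS pi_p (sqcl_mul (sqcl u) S) = Bstar muM muS pi_p S)
  /\ (n = 3 %[mod 4] ->
      Bstar muM muS pi_p (sqcl_mul (sqcl u) S)
      = (hilbert (val u) (val u))%:~R * Bstar muM muS pi_p S).
Proof.
have two0 := completion_two_neq0 iota.
have Kfin := completion_finite_residue p_neq0 K_completion.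
have Kunif : exists2 q : K, q != 0 & ord q = 1.
  by exists (val (repr pi_p)); first exact: (valP (repr pi_p)).
have [_ [_ Kcomplete]] := K_completion.
have [d d_dense] : exists d : nat -> K, forall x k, exists i, x - d i \in ordge k.
  have [c cinj] := numfield_countable F.
  (* Numbers that code no element of [F] are sent to 0; density uses only the values at codes. *)
  exists (fun i => iota (xget 0 [set f | c f = i])) => x k.
  have [f xf] := iota_approx K_completion x k; exists (c f).
  suff -> : xget 0 [set g | c g = c f] = f by [].
  by case: xgetP => [g _ /= /cinj//|/(_ f)]; case.
split; first exact: (Astar_scale muM_haar muS_haar d_dense).
rewrite (Bstar_scale muM_haar muS_haar d_dense two0 Kcomplete Kfin Kunif n_odd)//.
(* For odd [n] the binomial is [n] times [(n-1)/2], and [(n-1)/2] is even exactly when [n] is 1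
   modulo 4. *)
have bin_odd : odd 'C(n, 2) = odd (n.-1)./2 by rewrite bin2odd// oddM n_odd.
set h := hilbert _ _.
have hE : h ^+ 'C(n, 2) = if odd 'C(n, 2) then h else 1.
  have h2 : h ^+ 2 = 1 by rewrite expr2 hilbert_sqr.
  rewrite -{1}(odd_double_half 'C(n, 2)) exprD -mul2n exprM h2 expr1n mulr1.
  by case: (odd _).
rewrite hE bin_odd; split=> nmod.
  have -> : odd n.-1./2 = false by lia.
  by rewrite mul1r.
by have -> : odd n.-1./2 = true by lia.
Qed.
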